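(* Let $n,m\ge 1$, $k\ge 2$, $1\le s\le n$ be integers, let $E$ be a smooth manifold of dimension $n+m$, let $\theta\in J^{k-1}(E,n)$ be a point, and let $\mathcal C$ be the Cartan plane of $J^{k-1}(E,n)$ at $\theta$. Then the space $\mathcal I_s(\mathcal C)$ of $s$-dimensional horizontal integral elements of $\mathcal C$ is an affine bundle over the Grassmannian $\mathrm{Gr}(n,s)$ (with bundle projection $\Sigma\mapsto\underline\Sigma$), modeled on the vector bundle over $\mathrm{Gr}(n,s)$ given by the $k$-th homogeneous component of $$\frac{S^\bullet T^\ast}{\mu_{\boldsymbol\Sigma}^{k}}\otimes_{\mathbb R}N,\qquad N\cong\mathbb R^m .$$
   Context: $J^{k-1}(E,n)$ is the manifold of $(k-1)$-jets of $n$-dimensional submanifolds of $E$. The Cartan plane $\mathcal C$ at $\theta$ is the span of the tangent spaces at $\theta$ of the $(k-1)$-jet prolongations of all $n$-dimensional submanifolds of $E$ whose $(k-1)$-jet at the base point of $\theta$ is $\theta$. If $\theta=[L_0]^{k-1}_y$, the normal space is $N=T_yE/T_yL_0\cong\mathbb R^m$. Fix one $n$-dimensional horizontal integral element $L\le\mathcal C$ (e.g. the tangent space at $\theta$ of the $(k-1)$-jet prolongation of an $n$-dimensional submanifold of $E$ whose $(k-1)$-jet at $y$ is $\theta$), identified with $T_yL_0\cong\mathbb R^n$. Then $$\mathcal C=L\oplus (S^{k-1}L^\ast\otimes_{\mathbb R} N),$$ where $S^{k-1}L^\ast\otimes N$ (the homogeneous $N$-valued polynomials of degree $k-1$ on $L$)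 is the tangent space at $\theta$ of the fibre of $J^{k-1}(E,n)\to J^{k-2}(E,n)$. The curvature form of the Cartan distribution at $\theta$ is the $(S^{k-2}L^\ast\otimes N)$-valued alternating $2$-form $\Omega$ on $\mathcal C$ for which both $L$ and $S^{k-1}L^\ast\otimes N$ are isotropic and $\Omega(l,p)=p(l,\cdot,\dots,\cdot)\in S^{k-2}L^\ast\otimes N$ for $l\in L$, $p\in S^{k-1}L^\ast\otimes N$ ($p$ being regarded as a symmetric $(k-1)$-linear map). A subspace $\Sigma\le\mathcal C$ is horizontal if it is transversal to the fibres of $J^{k-1}(E,n)\to J^{k-2}(E,n)$, i.e. $\Sigma\cap (S^{k-1}L^\ast\otimes N)=0$, equivalently the projection $\mathcal C\to L$ is injective on $\Sigma$; it is integral if $\Omega|_\Sigma\equiv0$. Thus $$\mathcal I_s(\mathcal C)=\{\Sigma\le\mathcal C\mid \dim\Sigma=s,\ \Omega|_\Sigma\equiv0,\ \Sigma\text{ horizontal}\}.$$ For horizontal $\Sigma$, $\underline\Sigma$ denotes the image of $\Sigma$ under the projection $\mathcal C\to L\cong\mathbb R^n$. $\mathrm{Gr}(n,s)$ is the Grassmannian of $s$-dimensional subspaces of $L=\mathbb R^n$; $T=\mathrm{Gr}(n,s)\times L$ is the trivial bundle; $\boldsymbol\Sigma\subseteq T$ is the tautological sub-bundle, whose fibre at $\Sigma_0\in\mathrm{Gr}(n,s)$ is $\Sigma_0$; $S^\bullet T^\ast$ is the bundle of symmetric algebras of $T^\ast$, with homogeneous components regarded as vector bundles over $\mathrm{Gr}(n,s)$.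 $\mu_{\boldsymbol\Sigma}\subseteq S^\bullet T^\ast$ is the kernel of the restriction map $S^\bullet T^\ast\to S^\bullet\boldsymbol\Sigma^\ast$ (fibrewise: the ideal of polynomials on $L$ vanishing on $\Sigma_0$), and $\mu_{\boldsymbol\Sigma}^k$ is its $k$-th power. *)

(* Defs.v *)
From mathcomp Require Import all_boot all_order all_algebra.
From mathcomp Require Import all_classical all_reals all_analysis.
(* The notations of mpoly clash with those of MathComp-Analysis. *)
From mathcomp Require Import (canonicals, coercions) mpoly.

Set Implicit Arguments.
Unset Strict Implicit.
Unset Printing Implicit Defensive.

Import Order.TTheory GRing.Theory Num.Theory.
Import numFieldNormedType.Exports.

Local Open Scope classical_set_scope.
Local Open Scope ring_scope.

Section SmoothStructures.
Context {R : realType}.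

Definition iter_derive (U V : normedModType R) (vs : seq U) (f : U -> V) :
    U -> V :=
  foldr (fun v g x => 'D_v g x) f vs.

(* C^oo on a neighbourhood of [a]; adequate because [U] is always
   finite-dimensional here. *)
Definition smooth_at (U V : normedModType R) (f : U -> V) (a : U) : Prop :=
  \forall x \near a, forall vs : seq U,
    {for x, continuous (iter_derive vs f)} /\
    forall v, derivable (iter_derive vs f) x v.

(* Smooth structures are given by families of local parametrizations
   (inverse charts) modelled on a finite-dimensional normed space [U]. *)
Record param (U : normedModType R) (X : Type) :=
  Param { pdom : set U; pmap :> U -> X }.

(* The transition map from [c] to [d] has open domain and is smooth. *)
Definition compatible (U : normedModType R) (X : Type) (c d : param U X) :
    Prop :=
  forall a b, pdom c a -> pdom d b -> c a = d b ->
  exists g : U -> U, smooth_at g a /\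
    \forall x \near a, pdom d (g x) /\ d (g x) = c x.

(* Membership in the maximal atlas generated by [A]. *)
Definition admissible (U : normedModType R) (X : Type)
    (A : set (param U X)) (c : param U X) : Prop :=
  [/\ open (pdom c), set_inj (pdom c) c &
      forall d, A d -> compatible c d /\ compatible d c].

Definition atlas_open (U : normedModType R) (X : Type)
    (A : set (param U X)) (O : set X) : Prop :=
  forall c, A c -> open (pdom c `&` c @^-1` O).

Definition smooth_manifold (U : normedModType R) (X : Type)
    (A : set (param U X)) : Prop :=
  [/\ forall c, A c -> admissible A c,
      forall y : X, exists c a, [/\ A c, pdom c a & c a = y],
      forall x y : X, x <> y -> exists O O' : set X,
        [/\ atlas_open A O, atlas_open A O', O x, O' y & O `&` O' = set0] &
      exists B : nat -> set X, (forall i, atlas_open A (B i)) /\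
        forall O x, atlas_open A O -> O x -> exists i, B i x /\ B i `<=` O].

(* Smoothness at [x] of [f] restricted to a subset [D] of [X], in the sense
   that [f] extends smoothly to a neighbourhood of [x] in [X]; when [D] is
   open this is ordinary smoothness. *)
Definition smooth_within (U V : normedModType R) (X Y : Type)
    (A : set (param U X)) (B : set (param V Y)) (D : set X) (f : X -> Y)
    (x : X) : Prop :=
  forall c a, A c -> pdom c a -> c a = x ->
  exists d g, [/\ B d, smooth_at g a &
    \forall a' \near a, D (c a') -> pdom d (g a') /\ d (g a') = f (c a')].

(* [W] need not be normed: only finite-dimensional subspaces matter. *)
Definition smooth_section (U : normedModType R) (X : Type)
    (A : set (param U X)) (W : lmodType R) (e : X -> W) (x : X) : Prop :=
  forall c a, A c -> pdom c a -> c a = x ->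
  exists (N : nat) (h : U -> 'rV[R]_N) (w : 'I_N -> W), smooth_at h a /\
    \forall a' \near a, e (c a') = \sum_i h a' 0 i *: w i.

Definition vector_atlas (V : normedModType R) : set (param V V) :=
  [set Param setT id].
Arguments vector_atlas V : clear implicits.

Definition prod_param (U V : normedModType R) (X : Type) (c : param U X) :
    param (U * V)%type (X * V) :=
  Param (fst @^-1` pdom c) (fun z : U * V => (c z.1, z.2)).

Definition prod_atlas (U V : normedModType R) (X : Type)
    (A : set (param U X)) : set (param (U * V)%type (X * V)) :=
  @prod_param U V X @` A.
Arguments prod_atlas [U] V [X] A.

Definition grass (V : vectType R) (s : nat) : set {vspace V} :=
  [set F | \dim F = s].
Arguments grass V s : clear implicits.

(* For a basis [e ++ f] of [V]: the graph of the linear map <<e>> -> <<f>>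
   of matrix [M]. *)
Definition graph_span (V : vectType R) (s t : nat) (e : s.-tuple V)
    (f : t.-tuple V) (M : 'M[R]_(s, t)) : {vspace V} :=
  <<[seq (tnth e i + \sum_j M i j *: tnth f j)%R | i <- enum 'I_s]>>%VS.

(* The standard affine charts of Gr(V, s). *)
Definition grass_atlas (V : vectType R) (s : nat) :
    set (param 'M[R]_(s, \dim {:V} - s) {vspace V}) :=
  [set c | exists (e : s.-tuple V) (f : (\dim {:V} - s).-tuple V),
     basis_of fullv (e ++ f) /\ c = Param setT (graph_span e f)].
Arguments grass_atlas V s : clear implicits.

(* [p : I -> G] is a smooth affine bundle over the manifold [(G, B)], with
   total space an embedded submanifold [I] of [(X, A)], modelled on the
   quotient vector bundle with fibre [W / K b] at [b] of the trivial bundle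
   [G * W].  [add x w] is the translate of [x] by the class of [w]. *)
Definition smooth_affine_bundle (U V : normedModType R) (X Y : Type)
    (A : set (param U X)) (I : set X) (B : set (param V Y)) (G : set Y)
    (p : X -> Y) (W : lmodType R) (K : Y -> set W) : Prop :=
  exists (r : nat) (add : X -> W -> X),
  [/\ forall x, I x -> G (p x) /\ smooth_within A B I p x,
      (* each fibre is a principal homogeneous space of [W / K b] *)
      forall x, I x ->
        [/\ forall w, I (add x w) /\ p (add x w) = p x,
            forall w w', add (add x w) w' = add x (w + w'),
            forall w, add x w = x <-> K (p x) w &
            forall x', I x' -> p x' = p x -> exists w, x' = add x w] &
      forall b, G b -> exists (O : set Y) (e : 'I_r -> Y -> W)
          (coor : W -> Y -> 'rV[R]_r) (sigma : Y -> X) (zeta : X -> 'rV[R]_r),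
        let psi (y : Y * 'rV[R]_r) :=
          add (sigma y.1) (\sum_i y.2 0 i *: e i y.1) in
        [/\ [/\ O b, O `<=` G & atlas_open B O],
            (* [e] is a local frame of the quotient vector bundle, and
               [coor w] the coordinates in it of the constant section [w] *)
            forall b', O b' ->
              [/\ forall i, smooth_section B (e i) b',
                  forall w, smooth_within B (vector_atlas 'rV[R]_r) O
                              (coor w) b' &
                  forall w z, K b' (w - \sum_i z 0 i *: e i b') <->
                              z = coor w b'],
            forall b', O b' -> I (sigma b') /\ p (sigma b') = b',
            (* [psi] is a diffeomorphism of [O * R^r] onto the part of [I]
               over [O], with inverse [x |-> (p x, zeta x)] *)
            forall b' z, O b' ->
              smooth_within (prod_atlas 'rV[R]_r B) A (fst @^-1` O) psi
                (b', z) &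
            forall x, I x -> O (p x) -> psi (p x, zeta x) = x /\
              smooth_within A (vector_atlas 'rV[R]_r) (I `&` p @^-1` O)
                zeta x]].

End SmoothStructures.
Arguments smooth_affine_bundle {R U V X Y} A I B G p W K.
Arguments grass {R} V s.
Arguments grass_atlas {R} V s.

(* Coordinates on jets.  In a local parametrization [c] of [E] by
   R^(n + m), [n]-dimensional submanifolds transversal to the last [m]
   coordinates are graphs of maps f : R^n -> R^m, and the q-jet at the point
   over x has coordinates (x, (d_w f (x))_w), where w ranges over the words
   of length <= q in the indices of the partial derivatives.  These
   coordinates are redundant (d_w depends only on w up to permutation): J^q
   is embedded in the space of all arrays indexed by words. *)
Notation jet_coords R n m q :=
  ('rV[R]_n * {ffun q.-bseq 'I_n -> 'rV[R]_m})%type.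

Section Jets.
Context {R : realType} (n m : nat).
Local Notation L := 'rV[R]_n.
Local Notation N := 'rV[R]_m.
Local Notation arr q := {ffun q.-bseq 'I_n -> N}.
Local Notation jetT q := (jet_coords R n m q).

(* [S] is, near [c a], the graph of [f] in the coordinates [c]. *)
Definition graph_near (E : Type) (c : param 'rV[R]_(n + m) E)
    (a : 'rV[R]_(n + m)) (S : set E) (f : L -> N) : Prop :=
  smooth_at f (lsubmx a) /\
  \forall z \near a, S (c z) <-> rsubmx z = f (lsubmx z).

Definition submanifold (E : Type) (A : set (param 'rV[R]_(n + m) E))
    (S : set E) : Prop :=
  forall y, S y -> exists c a f,
    [/\ admissible A c, pdom c a, c a = y & graph_near c a S f].

Definition partials (w : seq 'I_n) (f : L -> N) : L -> N :=
  iter_derive [seq delta_mx 0 i | i <- w] f.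

Definition same_jet (q : nat) (f g : L -> N) (x : L) : Prop :=
  forall w : seq 'I_n, (size w <= q)%N -> partials w f x = partials w g x.

(* Image of [v] under the differential at [x] of the prolongation
   x |-> (x, (d_w f (x))_w). *)
Definition prolong_tangent (q : nat) (f : L -> N) (x v : L) : jetT q :=
  (v, [ffun w : q.-bseq 'I_n => 'D_v (partials w f) x]).

(* The Cartan plane at the q-jet at [c a] of the graph of [f]: the span (as
   the intersection of all subspaces containing them) of the tangent spaces
   to the prolongations of the submanifolds with that q-jet.  Contact of
   order q is read in [c]; it does not depend on the coordinates. *)
Definition cartan_plane (q : nat) (E : Type)
    (A : set (param 'rV[R]_(n + m) E)) (c : param 'rV[R]_(n + m) E)
    (a : 'rV[R]_(n + m)) (f : L -> N) : set (jetT q) :=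
  [set z | forall F : {vspace jetT q},
     (forall S g v, submanifold A S -> S (c a) -> graph_near c a S g ->
        same_jet q g f (lsubmx a) ->
        prolong_tangent q g (lsubmx a) v \in F) ->
     z \in F].

(* Tangent space of the fibre of J^q -> J^(q - 1). *)
Definition fibre_tangent (q : nat) : set (jetT q) :=
  [set z : jetT q | z.1 = 0 /\ forall w : q.-bseq 'I_n, (size w < q)%N -> z.2 w = 0].

(* Projection of a tangent vector to the fibre of J^q -> J^(q - 1) along
   the integral element L tangent to the prolongation of the graph of [f]. *)
Definition vertical_part (q : nat) (f : L -> N) (x : L) (z : jetT q) : arr q :=
  z.2 - (prolong_tangent q f x z.1).2.

(* p |-> p(l, ., ..., .), the array (p_w), size w = q, being that of the
   coefficients p(e_w1, ..., e_wq) of a q-linear map. *)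
Definition contract (q : nat) (l : L) (p : arr q) :
    {ffun q.-1.-tuple 'I_n -> N} :=
  [ffun t : q.-1.-tuple 'I_n =>
     \sum_i l 0 i *: p (insub_bseq q (i :: t))].

Definition curvature (q : nat) (f : L -> N) (x : L) (z z' : jetT q) :
    {ffun q.-1.-tuple 'I_n -> N} :=
  contract z.1 (vertical_part f x z') - contract z'.1 (vertical_part f x z).

Definition integral_elements (q s : nat) (E : Type)
    (A : set (param 'rV[R]_(n + m) E)) (c : param 'rV[R]_(n + m) E)
    (a : 'rV[R]_(n + m)) (f : L -> N) : set {vspace jetT q} :=
  [set F | [/\ \dim F = s,
     forall z, z \in F -> cartan_plane A c a f z,
     forall z z', z \in F -> z' \in F -> curvature f (lsubmx a) z z' = 0 &
     forall z, z \in F -> fibre_tangent z -> z = 0]].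

Definition underline (q : nat) (F : {vspace jetT q}) : {vspace L} :=
  (linfun (@fst L (arr q)) @: F)%VS.

End Jets.
Arguments cartan_plane {R n m} q [E] A c a f.
Arguments integral_elements {R n m} q s [E] A c a f.
Arguments underline {R n m} q F.

Definition ideal_exp (S : comNzRingType) (J : set S) (k : nat) : set S :=
  [set p | exists (N : nat) (c : 'I_N -> S) (q : 'I_N -> 'I_k -> S),
     (forall i j, J (q i j)) /\ p = \sum_i c i * \prod_j q i j].

(* S^. L^* is the polynomial ring in the coordinate functions of L = R^n. *)
Definition vanishing_ideal {R : realType} (n : nat)
    (F : {vspace 'rV[R]_n}) : set (mpoly.mpoly n R) :=
  [set p | forall x : 'rV[R]_n, x \in F -> mpoly.meval (x 0) p = 0].

(* N-valued homogeneous polynomials of degree k on L, N = R^m. *)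
Notation homog_poly R n m k := {ffun 'I_m -> mpoly.dhomog n R k}.

(* [homog_poly R n m k / model_kernel F] is the k-th homogeneous component
   of (S^. L^* / mu_F^k) (x) N. *)
Definition model_kernel {R : realType} (n m k : nat)
    (F : {vspace 'rV[R]_n}) : set (homog_poly R n m k) :=
  [set w | forall j, ideal_exp (vanishing_ideal F) k
                       (mpoly.mpoly_of_dhomog (w j))].
Arguments model_kernel {R} n m k F.

(* Main.v *)
(* In the coordinates given by the integral element L, a horizontal integral
   element is the graph of a linear map phi : b -> S^(k-1) L^* (x) N with
   phi(l)(l', ., ..., .) = phi(l')(l, ., ..., .) for l, l' in its projection b,
   and w in S^k L^* (x) N acts by adding l |-> d_l w to phi.
   - The action is transitive on each fibre: by the Poincare lemma for
     polynomials, two such phi on b differ by l |-> d_l w for some w.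
   - The stabilizer of phi consists of the w with d_l w = 0 for all l in b.  By
     Euler's identity these are the polynomials of degree k in the linear forms
     vanishing on b, that is, the component of degree k of mu_b^k.
   - The dimension of this stabilizer depends only on that of b, so a basis of a
     complement at b0 is a local frame of the model bundle near b0.  Coordinates
     in this frame solve an injective linear system with smooth coefficients.
   That the Cartan plane is L + S^(k-1) L^* (x) N amounts to the symmetry of
   iterated derivatives, and to perturbing f by polynomials of degree k. *)

(* The delicate point is smoothness rather than algebra. The coordinates in the frame of the model
   bundle and the fibre coordinate of an integral element are obtained by choice, point by point,
   with no formula at hand. Each of them is however the unique solution of an overdetermined linear
   system whose coefficients are smooth in the charts of the Grassmannians, and least squares solves
   such a system by a rational formula. The formula makes sense near every point where the system is
   injective, whether or not a solution exists; this provides the smooth extension to all nearby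
   subspaces that [smooth_within] requires, although subspaces near an integral element need not be
   integral. Maps into a Grassmannian are treated through spans of smoothly varying free families.
   Since [smooth_at] speaks of directional derivatives only, additivity in the direction and
   symmetry of second derivatives are drawn from the mean value theorem along lines. *)
From HB Require Import structures.
Require Import Defs.
From mathcomp Require Import all_boot all_order all_algebra.
From mathcomp Require Import all_classical all_reals all_analysis.
From mathcomp Require Import (canonicals, coercions) mpoly.

Set Implicit Arguments.
Unset Strict Implicit.
Unset Printing Implicit Defensive.

Import Order.TTheory GRing.Theory Num.Theory.
Import numFieldNormedType.Exports.
Local Open Scope classical_set_scope.
Local Open Scope ring_scope.

(** * Calculus of smooth maps *)

Section SmoothCalculus.
Context {R : realType}.

(** The recursion removes the innermost derivative, so that the product and quotient rules can be
    used by induction on [k]. Order 0 already includes directional differentiability, as [smooth_at]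
    does for the empty word. *)
Fixpoint Ck (U V : normedModType R) (O : set U) (k : nat) (f : U -> V) : Prop :=
  (forall x, O x -> {for x, continuous f} /\ forall v, derivable f x v) /\
  if k is k'.+1 then forall v, Ck O k' ('D_v f) else True.

Lemma Ck0 (U V : normedModType R) (O : set U) k (f : U -> V) x :
  Ck O k f -> O x -> {for x, continuous f} /\ forall v, derivable f x v.
Proof. by case: k => [|k] [H _]; apply: H. Qed.

Lemma smooth_atP (U V : normedModType R) (f : U -> V) a :
  smooth_at f a <-> exists O, [/\ open O, O a & forall k, Ck O k f].
Proof.
split=> [sm|[ O [ oO Oa fC]]].
  exists (interior [set x | forall vs : seq U,
      {for x, continuous (iter_derive vs f)} /\
      forall v, derivable (iter_derive vs f) x v]); split.
  - exact: open_interior.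
  - exact: sm.
  move=> k; suff H O : (forall x, O x -> forall vs : seq U,
      {for x, continuous (iter_derive vs f)} /\
      forall v, derivable (iter_derive vs f) x v) -> Ck O k f.
    by apply: H => x /interior_subset.
  elim: k f {sm} => [|k IH] f Of; first by split=> // x /Of /(_ [::]).
  split=> [x /Of /(_ [::]) //|v]; apply: IH => x Ox vs.
  by have := Of x Ox (rcons vs v); rewrite /iter_derive foldr_rcons.
near=> x => vs.
have Ox : O x by near: x; apply: open_nbhs_nbhs.
have := fC (size vs).
elim/last_ind: vs f {fC} => [|vs v IH] f; first by move=> /Ck0; apply.
by rewrite size_rcons /iter_derive foldr_rcons => -[_ /(_ v)]; apply: IH.
Unshelve. all: by end_near. Qed.

Lemma CkS (U V : normedModType R) (O : set U) k (f : U -> V) :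
  Ck O k.+1 f -> Ck O k f.
Proof.
elim: k f => [|k IH] f; first by case.
by move=> [ Of fC]; split=> // v; apply/IH/fC.
Qed.

Lemma Ck_sub (U V : normedModType R) (O O' : set U) k (f : U -> V) :
  O' `<=` O -> Ck O k f -> Ck O' k f.
Proof.
move=> sO; elim: k f => [|k IH] f [ Of fC]; first by split=> // x /sO /Of.
by split=> [x /sO /Of //|v]; exact/IH/fC.
Qed.

Lemma near_eq_continuous (U V : topologicalType) (f g : U -> V) x :
  (\forall y \near x, f y = g y) -> {for x, continuous f} ->
  {for x, continuous g}.
Proof.
move=> fg fc; have gfx := nbhs_singleton fg.
change (g @ x --> g x); rewrite -gfx; apply: cvg_trans fc.
by apply: near_eq_cvg; apply: filterS fg => y ->.
Qed.

Lemma eq_Ck (U V : normedModType R) (O : set U) k (f g : U -> V) : open O ->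
  (forall x, O x -> f x = g x) -> Ck O k f -> Ck O k g.
Proof.
move=> oO; elim: k f g => [|k IH] f g fg fC.
  split=> // x Ox; have [fc fd] := Ck0 fC Ox.
  have nfg : \near x, f x = g x.
    by near=> y; apply: fg; near: y; apply: open_nbhs_nbhs.
  split=> [|v]; last exact: near_eq_derivable (fd v).
  exact: near_eq_continuous fc.
split=> [x Ox|v].
  have [fc fd] := Ck0 fC Ox.
  have nfg : \near x, f x = g x.
    by near=> y; apply: fg; near: y; apply: open_nbhs_nbhs.
  split=> [|v]; last exact: near_eq_derivable (fd v).
  exact: near_eq_continuous fc.
apply: IH (fC.2 v) => x Ox; apply: near_eq_derive.
by near=> y; apply: fg; near: y; apply: open_nbhs_nbhs.
Unshelve. all: by end_near. Qed.

Lemma Ck_cst (U V : normedModType R) (O : set U) k (c : V) : Ck O k (cst c).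
Proof.
elim: k c => [|k IH] c.
  by split=> // x Ox; split=> [|v]; [exact: cvg_cst|exact: derivable_cst].
split=> [x Ox|v]; first by split=> [|v]; [exact: cvg_cst|exact: derivable_cst].
suff -> : 'D_v (cst c) = cst 0 :> (U -> V) by apply: IH.
by apply/funext => x; rewrite derive_cst.
Qed.

Lemma CkD (U V : normedModType R) (O : set U) k (f g : U -> V) : open O ->
  Ck O k f -> Ck O k g -> Ck O k (f + g).
Proof.
move=> oO; elim: k f g => [|k IH] f g fC gC.
  split=> // x Ox; have [fc fd] := Ck0 fC Ox; have [gc gd] := Ck0 gC Ox.
  by split=> [|v]; [exact: continuousD|exact: derivableD].
split=> [x Ox|v].
  have [fc fd] := Ck0 fC Ox; have [gc gd] := Ck0 gC Ox.
  by split=> [|v]; [exact: continuousD|exact: derivableD].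
apply: eq_Ck (IH _ _ (fC.2 v) (gC.2 v)) => // x Ox.
by rewrite deriveD//; [have [] := Ck0 fC Ox|have [] := Ck0 gC Ox].
Qed.

Lemma CkM (U : normedModType R) (O : set U) k (f g : U -> R^o) : open O ->
  Ck O k f -> Ck O k g -> Ck O k (f * g).
Proof.
move=> oO; elim: k f g => [|k IH] f g fC gC.
  split=> // x Ox; have [fc fd] := Ck0 fC Ox; have [gc gd] := Ck0 gC Ox.
  by split=> [|v]; [exact: continuousM|exact: derivableM].
split=> [x Ox|v].
  have [fc fd] := Ck0 fC Ox; have [gc gd] := Ck0 gC Ox.
  by split=> [|v]; [exact: continuousM|exact: derivableM].
apply: (@eq_Ck _ _ _ _ (f * 'D_v g + g * 'D_v f)) => //.
  move=> x Ox.
  by rewrite deriveM//; [have [] := Ck0 fC Ox|have [] := Ck0 gC Ox].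
apply: CkD => //; apply: IH; rewrite ?(fC.2, gC.2)//; [exact: CkS fC|exact: gC.2|exact: CkS gC|exact: fC.2].
Qed.

Lemma CkV (U : normedModType R) (O : set U) k (f : U -> R^o) : open O ->
  (forall x, O x -> f x != 0) ->
  Ck O k f -> Ck O k (fun x => (f x)^-1 : R^o).
Proof.
move=> oO f0; elim: k => [|k IH] fC.
  split=> // x Ox; have [fc fd] := Ck0 fC Ox.
  split=> [|v]; last exact: derivableV (f0 _ Ox) (fd v).
  exact: cvgV (f0 _ Ox) fc.
split=> [x Ox|v].
  have [fc fd] := Ck0 fC Ox.
  split=> [|v]; last exact: derivableV (f0 _ Ox) (fd v).
  exact: cvgV (f0 _ Ox) fc.
pose g : U -> R^o := fun x => (f x)^-1.
(* The derivative of the reciprocal is minus its square times ['D_v f]: the reciprocal reappears,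
   with one order less to prove. *)
apply: (@eq_Ck _ _ _ _ (cst (- 1 : R^o) * ((g * g) * 'D_v f))) => //.
  move=> x Ox; rewrite deriveV ?f0//; last by have [] := Ck0 fC Ox.
  by rewrite -exprVn expr2 /= mulN1r scaleNr.
apply: CkM => //; first exact: Ck_cst.
apply: CkM => //; last exact: fC.2.
by apply: CkM => //; apply/IH/CkS.
Qed.

(** The derivative in the direction [v] does not depend on the point, so all further derivatives
    vanish. *)
Lemma Ck_lin (U V : normedModType R) (O : set U) k (f : U -> V) (df : U -> V) :
  continuous f -> (forall x v, is_derive x v f (df v)) -> Ck O k f.
Proof.
move=> fc fd; case: k => [|k].
  by split=> // x Ox; split=> [|v]; [exact: fc|exact: ex_derive].
split=> [x Ox|v]; first by split=> [|v]; [exact: fc|exact: ex_derive].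
suff -> : 'D_v f = cst (df v) by apply: Ck_cst.
by apply/funext => x; rewrite derive_val.
Qed.

Lemma mx_continuous (U : topologicalType) p r (M : U -> 'M[R]_(p, r)) x :
  (forall i j, {for x, continuous (fun y => M y i j : R^o)}) ->
  {for x, continuous M}.
Proof.
move=> Mc A [P PM sPA]; rewrite /nbhs /=.
have : \forall y \near x, forall i j, P i j (M y i j).
  apply: filter_forall => i; apply: filter_forall => j.
  exact: Mc (PM i j).
by apply: filterS => y Py; apply: sPA => i j; apply: Py.
Qed.

Lemma Ck_mx (U : normedModType R) p r (O : set U) k (M : U -> 'M[R]_(p, r)) :
  open O ->
  Ck O k M <-> forall i j, Ck O k (fun x => M x i j : R^o).
Proof.
move=> oO; elim: k M => [|k IH] M; split=> [MC i j|MC].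
- split=> // x Ox; have [Mc Md] := Ck0 MC Ox; split.
    exact: cvg_comp Mc (@coord_continuous _ _ _ i j _).
  by move=> v; exact: (derivable_mxP _ _ _).1 (Md v) i j.
- split=> // x Ox; split=> [|v].
    by apply: mx_continuous => i j; have [] := Ck0 (MC i j) Ox.
  by apply/derivable_mxP => i j; have [] := Ck0 (MC i j) Ox.
- split=> [x Ox|v].
    have [Mc Md] := Ck0 MC Ox; split.
      exact: cvg_comp Mc (@coord_continuous _ _ _ i j _).
    by move=> v; exact: (derivable_mxP _ _ _).1 (Md v) i j.
  apply: eq_Ck (((IH _).1 (MC.2 v)) i j) => // x Ox.
  by rewrite derive_mx ?mxE//; have [] := Ck0 MC Ox.
split=> [x Ox|v].
  split=> [|v].
    by apply: mx_continuous => i j; have [] := Ck0 (MC i j) Ox.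
  by apply/derivable_mxP => i j; have [] := Ck0 (MC i j) Ox.
apply/IH => i j; apply: eq_Ck ((MC i j).2 v) => // x Ox.
rewrite derive_mx ?mxE//.
by apply/derivable_mxP => i' j'; have [] := Ck0 (MC i' j') Ox.
Qed.

Lemma eq_smooth_at (U V : normedModType R) (f g : U -> V) a :
  (\forall x \near a, f x = g x) -> smooth_at f a -> smooth_at g a.
Proof.
move=> fg /smooth_atP[ O [ oO Oa fC]]; apply/smooth_atP.
exists (O `&` interior [set x | f x = g x]); split.
- by apply: openI => //; apply: open_interior.
- by [].
move=> k; apply: (@eq_Ck _ _ _ _ f); first by apply: openI => //; apply: open_interior.
  by move=> x [_ /interior_subset].
by apply: Ck_sub (fC k); apply: subIsetl.
Qed.

Lemma smooth_cst (U V : normedModType R) (c : V) (a : U) : smooth_at (fun=> c) a.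
Proof. by apply/smooth_atP; exists setT; split; [exact: openT| |move=> k; apply: Ck_cst]. Qed.

Lemma smoothD (U V : normedModType R) (f g : U -> V) a :
  smooth_at f a -> smooth_at g a -> smooth_at (fun x => f x + g x) a.
Proof.
move=> /smooth_atP[ O [ oO Oa fC]] /smooth_atP[ O' [ oO' Oa' gC]]; apply/smooth_atP.
exists (O `&` O'); split=> [| |k]; [exact: openI|by []|].
apply: CkD; first exact: openI.
  by apply: Ck_sub (fC k); apply: subIsetl.
by apply: Ck_sub (gC k); apply: subIsetr.
Qed.

Lemma smoothM (U : normedModType R) (f g : U -> R^o) a :
  smooth_at f a -> smooth_at g a -> smooth_at (fun x => f x * g x : R^o) a.
Proof.
move=> /smooth_atP[ O [ oO Oa fC]] /smooth_atP[ O' [ oO' Oa' gC]]; apply/smooth_atP.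
exists (O `&` O'); split=> [| |k]; [exact: openI|by []|].
apply: CkM; first exact: openI.
  by apply: Ck_sub (fC k); apply: subIsetl.
by apply: Ck_sub (gC k); apply: subIsetr.
Qed.

Lemma smooth_continuous (U V : normedModType R) (f : U -> V) a :
  smooth_at f a -> {for a, continuous f}.
Proof. by move=> /smooth_atP[ O [ oO Oa /(_ 0)/Ck0]] /(_ _ Oa)[]. Qed.

Lemma smooth_neq0 (U : normedModType R) (f : U -> R^o) a :
  smooth_at f a -> f a != 0 -> \forall x \near a, f x != 0.
Proof.
by move=> /smooth_continuous fc fa; exact: cvgr_neq0 fc fa.
Qed.

Lemma smoothV (U : normedModType R) (f : U -> R^o) a :
  f a != 0 -> smooth_at f a -> smooth_at (fun x => (f x)^-1 : R^o) a.
Proof.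
move=> fa fs; have nf := smooth_neq0 fs fa.
move: fs => /smooth_atP[ O [ oO Oa fC]]; apply/smooth_atP.
have oO' : open (O `&` interior [set x | f x != 0]).
  by apply: openI => //; apply: open_interior.
exists (O `&` interior [set x | f x != 0]); split=> // k.
apply: CkV => //; first by move=> x [_ /interior_subset].
by apply: Ck_sub (fC k); apply: subIsetl.
Qed.

Lemma smooth_mx (U : normedModType R) p r (M : U -> 'M[R]_(p, r)) a :
  (forall i j, smooth_at (fun x => M x i j : R^o) a) <-> smooth_at M a.
Proof.
split=> [Ms|/smooth_atP[ O [ oO Oa MC]] i j]; last first.
  by apply/smooth_atP; exists O; split=> // k; apply: (Ck_mx _ _ _).1.
have /choice[ O HO] : forall ij : 'I_p * 'I_r, exists O, [/\ open O, O a &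
    forall k, Ck O k (fun x => M x ij.1 ij.2 : R^o)].
  by move=> [i j]; apply/smooth_atP.
apply/smooth_atP.
pose P := interior [set x | forall ij, O ij x].
have oP : open P by apply: open_interior.
exists P; split=> // [|k].
  apply: filter_forall => ij; have [oOi Oia _] := HO ij.
  exact: open_nbhs_nbhs.
apply/Ck_mx => // i j; have [_ _ /(_ k)] := HO (i, j); apply: Ck_sub.
by move=> x /interior_subset /(_ (i, j)).
Qed.

Lemma smooth_sum (U V : normedModType R) (I : Type) (r : seq I) (P : pred I)
    (F : I -> U -> V) a :
  (forall i, P i -> smooth_at (F i) a) ->
  smooth_at (fun x => \sum_(i <- r | P i) F i x) a.
Proof.
move=> Fs; elim: r => [|i r IH].
  under eq_fun do rewrite big_nil; exact: smooth_cst.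
under eq_fun do rewrite big_cons.
by case Pi: (P i); [exact: (smoothD (Fs _ Pi) IH)|exact: IH].
Qed.

Lemma smooth_prod (U : normedModType R) (I : Type) (r : seq I) (P : pred I)
    (F : I -> U -> R^o) a :
  (forall i, P i -> smooth_at (F i) a) ->
  smooth_at (fun x => \prod_(i <- r | P i) F i x : R^o) a.
Proof.
move=> Fs; elim: r => [|i r IH].
  under eq_fun do rewrite big_nil; exact: smooth_cst.
under eq_fun do rewrite big_cons.
by case Pi: (P i); [exact: (smoothM (Fs _ Pi) IH)|exact: IH].
Qed.

Lemma is_derive_coord p r i j (M N : 'M[R]_(p, r)) :
  is_derive M N (fun M : 'M[R]_(p, r) => M i j : R^o) (N i j).
Proof.
have dM : derivable (@id 'M[R]_(p, r)) M N by exact: derivable_id.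
apply: DeriveDef; first exact: (derivable_mxP _ _ _).1 dM i j.
have := derive_mx dM; rewrite derive_id => /matrixP/(_ i j) ->.
by rewrite mxE.
Qed.

Lemma smooth_coord p r i j (A : 'M[R]_(p, r)) :
  smooth_at (fun M : 'M[R]_(p, r) => M i j : R^o) A.
Proof.
apply/smooth_atP; exists setT; split=> // [|k]; first exact: openT.
refine (@Ck_lin 'M[R]_(p, r) R^o setT k (fun M => M i j) (fun M => M i j) _ _).
  exact: coord_continuous.
by move=> M N; apply: is_derive_coord.
Qed.

Lemma smooth_det (U : normedModType R) p (M : U -> 'M[R]_p) a :
  smooth_at M a -> smooth_at (fun x => \det (M x) : R^o) a.
Proof.
move=> /smooth_mx Ms; rewrite /determinant; apply: smooth_sum => s _.
by apply: smoothM; [exact: smooth_cst|apply: smooth_prod => i _].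
Qed.

Lemma smooth_invmx (U : normedModType R) p (M : U -> 'M[R]_p) a :
  M a \in unitmx -> smooth_at M a -> smooth_at (fun x => invmx (M x)) a.
Proof.
move=> Mu Ms; have ds := smooth_det Ms.
have da : \det (M a) != 0 by rewrite -unitfE -unitmxE.
(* The adjugate formula agrees with [invmx] only where the determinant is nonzero, which is a
   neighbourhood of [a]. *)
pose N x := (\det (M x))^-1 *: \adj (M x).
apply: (@eq_smooth_at _ _ N).
  have := smooth_neq0 ds da; apply: filterS => x dx.
  by rewrite /N /invmx unitmxE unitfE dx.
apply/smooth_mx => i j.
under eq_fun do rewrite mxE mxE /cofactor.
apply: smoothM; first exact: smoothV.
apply: smoothM; first exact: smooth_cst.
apply: smooth_det; apply/smooth_mx => i' j'.
under eq_fun do rewrite !mxE.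
exact: (smooth_mx _ _).2.
Qed.

Lemma smooth_mulmx (U : normedModType R) p r t (M : U -> 'M[R]_(p, r))
    (N : U -> 'M[R]_(r, t)) a :
  smooth_at M a -> smooth_at N a -> smooth_at (fun x => M x *m N x) a.
Proof.
move=> /smooth_mx Ms /smooth_mx Ns; apply/smooth_mx => i j.
under eq_fun do rewrite mxE.
by apply: smooth_sum => l _; apply: smoothM.
Qed.

End SmoothCalculus.

(** * Smooth solutions of linear systems and smooth families of subspaces *)

Section SmoothLinearAlgebra.
Context {R : realType}.

(** A [vectType] carries no norm, so smoothness is tested on all linear functionals; in finite
    dimension this is smoothness of the coordinates. *)
Definition smooth_vect (U : normedModType R) (V : vectType R) (u : U -> V) a :=
  forall l : {linear V -> R^o}, smooth_at (fun x => l (u x)) a.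

(* Least squares: a solution is read off the Gram matrix of the system, which
   is invertible as soon as the system is injective. *)
Lemma smooth_solve (U : normedModType R) r (I : finType)
    (A : 'I_r -> I -> U -> R^o) (y : I -> U -> R^o) (a : U) :
  (forall j t, smooth_at (A j t) a) -> (forall t, smooth_at (y t) a) ->
  (forall z : 'rV[R]_r, (forall t, \sum_j z 0 j * A j t a = 0) -> z = 0) ->
  exists g : U -> 'rV[R]_r, smooth_at g a /\
    \forall x \near a, forall z : 'rV[R]_r,
      (forall t, \sum_j z 0 j * A j t x = y t x) -> z = g x.
Proof.
move=> As ys inj.
pose G x : 'M[R]_r := \matrix_(i, j) \sum_t A i t x * A j t x.
pose Y x : 'rV[R]_r := \row_j \sum_t y t x * A j t x.
have Gs : smooth_at G a.
  apply/smooth_mx => i j; under eq_fun do rewrite mxE.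
  by apply: smooth_sum => t _; apply: smoothM.
have Ys : smooth_at Y a.
  apply/smooth_mx => i j; under eq_fun do rewrite mxE.
  by apply: smooth_sum => t _; apply: smoothM.
have Ga : \det (G a) != 0.
  apply/negP => /det0P[z z0 zG]; move/eqP: z0; apply; apply: inj.
  pose c t := \sum_i z 0 i * A i t a.
  have cA j : \sum_t c t * A j t a = 0.
    transitivity ((z *m G a) 0 j); last by rewrite zG mxE.
    rewrite mxE.
    under eq_bigr do rewrite /c mulr_suml.
    rewrite exchange_big /=; apply: eq_bigr => i _.
    by rewrite mxE mulr_sumr; apply: eq_bigr => t _; rewrite mulrA.
  (* [c] is a combination of the vectors [A j] and is orthogonal to each of them, hence to itself;
     over the reals it vanishes, and injectivity at [a] applies. *)
  have /eqP : \sum_t c t ^+ 2 = 0.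
    transitivity (\sum_j z 0 j * \sum_t c t * A j t a).
      under [RHS]eq_bigr do rewrite mulr_sumr.
      rewrite exchange_big /=; apply: eq_bigr => t _.
      by rewrite expr2 {2}/c mulr_sumr; apply: eq_bigr => j _; rewrite mulrCA.
    by apply: big1 => j _; rewrite cA mulr0.
  rewrite psumr_eq0 => [/allP c0 t|t _]; last exact: sqr_ge0.
  by apply/eqP; rewrite -sqrf_eq0; apply: c0; rewrite mem_index_enum.
exists (fun x => Y x *m invmx (G x)); split.
  apply: (smooth_mulmx Ys); apply: (smooth_invmx _ Gs).
  by rewrite unitmxE unitfE.
(* Any solution of the system also solves the normal equations [z *m G x = Y x], whose matrix is
   still invertible near [a]. *)
have := smooth_neq0 (smooth_det Gs) Ga; apply: filterS => x Gx z zA.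
have Gu : G x \in unitmx by rewrite unitmxE unitfE.
apply: (canRL (mulmxK Gu)); apply/rowP => j; rewrite !mxE.
under [RHS]eq_bigr do rewrite -zA mulr_suml.
rewrite exchange_big /=; apply: eq_bigr => i _.
by rewrite mxE mulr_sumr; apply: eq_bigr => t _; rewrite mulrA.
Qed.

(** The chart is centred at the span at [a]: [e] is the family at [a] and [f] a basis of a
    complement. In it the family has a coordinate matrix with blocks [P] and [Q], where [P a] is the
    identity; while [P] is invertible, changing the basis of the span by its inverse exhibits the
    graph of [invmx P *m Q]. *)
Lemma smooth_grass (U : normedModType R) (V : vectType R) s
    (u : 'I_s -> U -> V) (a : U) :
  (forall i, smooth_vect (u i) a) -> free [seq u i a | i <- enum 'I_s] ->
  exists (d : param _ _) (g : U -> 'M[R]_(s, \dim {:V} - s)),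
  [/\ grass_atlas V s d, smooth_at g a &
    \forall x \near a, pdom d (g x) /\
      d (g x) = <<[seq u i x | i <- enum 'I_s]>>%VS].
Proof.
move=> us fr.
pose e := [tuple u i a | i < s].
have fre : free e by rewrite /e /=.
have dimF : \dim <<e>> = s by move/eqP: fre; rewrite size_tuple.
pose f0 := vbasis <<e>>^C.
have szf : size f0 == (\dim {:V} - s)%N.
  by rewrite size_tuple dimv_compl dimF.
pose f := Tuple szf.
have bX : basis_of fullv (e ++ f).
  suff : basis_of (<<e>> + <<e>>^C)%VS (e ++ f0) by rewrite addv_complf.
  apply: cat_basis => /=.
  - by apply/directv_addP; rewrite capv_compl.
  - by rewrite /basis_of eqxx fre.
  - exact: vbasisP.
pose X := [tuple of e ++ f].
have decomp i x : u i x = \sum_j coord X (lshift _ j) (u i x) *: tnth e j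
                        + \sum_j coord X (rshift _ j) (u i x) *: tnth f j.
  rewrite {1}(coord_basis bX (memvf (u i x))) big_split_ord /=.
  congr (_ + _); apply: eq_bigr => j _; congr (_ *: _).
    by rewrite -(tnth_lshift e f) (tnth_nth 0).
  by rewrite -(tnth_rshift e f) (tnth_nth 0).
pose P x : 'M[R]_s := \matrix_(i, j) coord X (lshift _ j) (u i x).
pose Q x : 'M[R]_(s, \dim {:V} - s) := \matrix_(i, j) coord X (rshift _ j) (u i x).
have frX : free X := basis_free bX.
have Pa : P a = 1%:M.
  apply/matrixP => i j; rewrite !mxE.
  have -> : u i a = X`_(lshift (\dim {:V} - s) i).
    by rewrite -tnth_nth tnth_lshift tnth_mktuple.
  by rewrite coord_free // (inj_eq (@lshift_inj _ _)) .
have Ps : smooth_at P a.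
  apply/smooth_mx => i j; under eq_fun do rewrite mxE; exact: us.
have Qs : smooth_at Q a.
  apply/smooth_mx => i j; under eq_fun do rewrite mxE; exact: us.
exists (Param setT (graph_span e f)), (fun x => invmx (P x) *m Q x); split.
- by exists e, f.
- by apply: (smooth_mulmx _ Qs); apply: (smooth_invmx _ Ps); rewrite Pa unitmx1.
have Pa0 : \det (P a) != 0 by rewrite Pa det1 oner_eq0.
have := smooth_neq0 (smooth_det Ps) Pa0; apply: filterS => x Px; split=> //=.
have Pu : P x \in unitmx by rewrite unitmxE unitfE.
rewrite /graph_span; set M := invmx (P x) *m Q x.
pose v i := tnth e i + \sum_j M i j *: tnth f j.
have PM : P x *m M = Q x by rewrite mulKVmx.
have uv i : u i x = \sum_l P x i l *: v l.
  rewrite decomp; under [RHS]eq_bigr do rewrite scalerDr scaler_sumr.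
  rewrite big_split exchange_big /=; congr (_ + _).
    by apply: eq_bigr => j _; rewrite mxE.
  apply: eq_bigr => j _; under eq_bigr do rewrite scalerA.
  by rewrite -scaler_suml; congr (_ *: _); have /matrixP/(_ i j) := PM; rewrite !mxE.
have vu i : v i = \sum_l invmx (P x) i l *: u l x.
  under eq_bigr do rewrite uv scaler_sumr.
  rewrite exchange_big /= (bigD1 i) //= [X in _ + X]big1 ?addr0 => [|j ji].
    under eq_bigr do rewrite scalerA.
    rewrite -scaler_suml; have /matrixP/(_ i i) := mulVmx Pu.
    by rewrite !mxE eqxx => ->; rewrite scale1r.
  under eq_bigr do rewrite scalerA.
  rewrite -scaler_suml; have /matrixP/(_ i j) := mulVmx Pu.
  by rewrite !mxE eq_sym (negPf ji) => ->; rewrite scale0r.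
apply/eqP; rewrite eqEsubv; apply/andP; split; apply/span_subvP => _ /mapP[i _ ->].
  rewrite -/(v i) vu; apply: memv_suml => l _; apply: memvZ; apply: memv_span.
  by apply/mapP; exists l; rewrite ?mem_enum.
rewrite uv; apply: memv_suml => l _; apply: memvZ; apply: memv_span.
by apply/mapP; exists l; rewrite ?mem_enum.
Qed.

End SmoothLinearAlgebra.

(** * Directional derivatives: linearity and symmetry *)

Section DirectionalDerivatives.
Context {R : realType} {U : normedModType R}.
Implicit Types (f : U -> R^o) (x u v : U).

Lemma is_derive_line f x v (t : R) : derivable f (t *: v + x) v ->
  is_derive t 1 (fun s : R => f (s *: v + x)) ('D_v f (t *: v + x)).
Proof.
move=> fd; have E : (fun h : R => h^-1 *:
    (((fun s : R => f (s *: v + x)) \o shift t) (h *: 1) - f (t *: v + x))) =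
    (fun h : R => h^-1 *: ((f \o shift (t *: v + x)) (h *: v) - f (t *: v + x))).
  by apply/funext => h /=; rewrite [h *: 1]mulr1 scalerDl addrA.
by split; rewrite /derivable /derive E.
Qed.

Lemma line_MVT f x v :
  (forall t : R, 0 <= t <= 1 -> derivable f (t *: v + x) v) ->
  exists2 t : R, 0 <= t <= 1 & f (v + x) - f x = 'D_v f (t *: v + x).
Proof.
move=> fd; pose phi (s : R) := f (s *: v + x).
have [|||t t01] := @MVT R phi (fun t => 'D_v f (t *: v + x)) 0 1.
- exact: ltr01.
- by move=> t; rewrite in_itv /= => /andP[/ltW t0 /ltW t1]; apply/is_derive_line/fd/andP.
- apply: derivable_within_continuous => t; rewrite in_itv /= => t01.
  by have [] := is_derive_line (fd _ t01).
rewrite /phi scale1r scale0r add0r subr0 mulr1 => ->.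
by exists t => //; move: t01; rewrite in_itv /= => /andP[/ltW -> /ltW ->].
Qed.

Lemma is_derive_scale_arg (phi : R -> R^o) (c D : R) :
  is_derive (0 : R) 1 phi D -> is_derive (0 : R) 1 (phi \o *%R c) (c * D).
Proof.
move=> [d1 e1]; have c0 : c * 0 = 0 := mulr0 c.
have d2 : derivable ( *%R c : R^o -> R^o) 0 1.
  by apply/derivable1_diffP; exact: differentiableZ.
have d1' : derivable phi (c * 0) 1 := eq_ind_r (fun y => derivable phi y 1) d1 c0.
split.
  apply/derivable1_diffP; apply: differentiable_comp; apply/derivable1_diffP.
    exact: d2.
  exact: d1'.
have H : is_derive (0 : R) 1 (c \*: (id : R -> R^o)) (c *: 1).
  exact: is_deriveZ.
have [_ H2] := H; have := derive1_comp d2 d1'; rewrite !derive1E c0 e1 mulrC => ->.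
by congr (_ * _); apply: (etrans H2); exact: mulr1.
Qed.

Lemma is_deriveZv f x v (c : R) : derivable f x v ->
  is_derive x (c *: v) f (c * 'D_v f x).
Proof.
move=> fd; have x00 w : 0 *: w + x = x by rewrite scale0r add0r.
have fd0 : derivable f (0 *: v + x) v by rewrite x00.
have E : (fun h : R => f (h *: (c *: v) + x)) = (fun s : R => f (s *: v + x)) \o *%R c.
  by apply/funext => h /=; rewrite scalerA mulrC.
have [d2 e2] := is_derive_scale_arg c (is_derive_line fd0).
have fcv : derivable f x (c *: v) by apply/derivable1P; rewrite E.
have fcv0 : derivable f (0 *: (c *: v) + x) (c *: v) by rewrite x00.
have [_ e3] := is_derive_line fcv0.
rewrite E x00 in e3; rewrite x00 in e2.
by split=> //; exact: etrans (esym e3) e2.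
Qed.

Lemma DvZ f x v (c : R) : derivable f x v -> 'D_(c *: v) f x = c * 'D_v f x.
Proof. by move=> /(is_deriveZv c)[_ ->]. Qed.

Lemma derivableZv f x v (c : R) : derivable f x v -> derivable f x (c *: v).
Proof. by move=> /(is_deriveZv c)[]. Qed.

(** The difference quotient along [u + v] splits into one along [u] at [x] and one along [v] at the
    moving point [h *: u + x]. The mean value theorem turns the second into a value of ['D_v f] near
    [x], and continuity gives its limit. *)
Lemma derivable_DvD f x u v : derivable f x u ->
  (\forall y \near x, derivable f y v) -> {for x, continuous ('D_v f)} ->
  is_derive x (u + v) f ('D_u f x + 'D_v f x).
Proof.
move=> fu fv cv.
suff H : (fun h : R => h^-1 *: ((f \o shift x) (h *: (u + v)) - f x)) @ 0^' -->
    'D_u f x + 'D_v f x.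
  by split; [apply/cvg_ex; eexists; exact: H|exact: cvg_lim H].
have H1 : (fun h : R => h^-1 *: (f (h *: u + x) - f x)) @ 0^' --> 'D_u f x.
  exact: fu.
suff H2 : (fun h : R => h^-1 *: (f (h *: v + (h *: u + x)) - f (h *: u + x))) @ 0^'
    --> 'D_v f x.
  apply: cvg_trans (cvgD H1 H2); apply: near_eq_cvg; near=> h => /=.
  transitivity (h^-1 *: (f (h *: u + x) - f x) +
    h^-1 *: (f (h *: v + (h *: u + x)) - f (h *: u + x))); first by [].
  rewrite -scalerDr; congr (_ *: _); rewrite addrC addrA subrK /=.
  by rewrite scalerDr addrA [h *: v + _]addrC.
apply/cvgrPdist_le => /= e e0.
have /cvgrPdist_le/(_ _ e0) ce := cv.
have : \forall y \near x, `|'D_v f x - 'D_v f y| <= e /\ derivable f y v.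
  by apply: filterI fv.
move=> /nbhs_ballP[d /= d0 dP].
near=> h.
have h0 : h != 0 by near: h; exact: nbhs_dnbhs_neq.
have hd : `|h| * (`|u| + `|v|) < d.
  (* The summand 1 keeps the denominator positive when [u] and [v] are both zero. *)
  have K0 : 0 < `|u| + `|v| + 1 by rewrite ltr_wpDl // addr_ge0.
  have : `|h| < d / (`|u| + `|v| + 1).
    by near: h; apply: dnbhs0_lt; rewrite divr_gt0.
  rewrite ltr_pdivlMr //; apply: le_lt_trans.
  by rewrite ler_wpM2l // lerDl.
have inb (t : R) : 0 <= t <= 1 -> ball x d (t *: (h *: v) + (h *: u + x)).
  move=> /andP[t0 t1]; rewrite -ball_normE /ball_ /= addrA opprD addrCA subrr addr0 normrN.
  apply: le_lt_trans hd; rewrite (le_trans (ler_normD _ _)) // !normrZ mulrDr addrC lerD2l.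
  by rewrite (ger0_norm t0) ler_piMl // mulr_ge0.
have [t t01 ->] := @line_MVT f (h *: u + x) (h *: v)
   (fun t t01 => derivableZv (c := h) (dP _ (inb t t01)).2).
have [/= cP dP'] := dP _ (inb t t01).
by rewrite DvZ // /GRing.scale /= mulKf.
Unshelve. all: by end_near. Qed.

Lemma is_derive_shift_arg f z w c : derivable f (c + z) w ->
  is_derive z w (fun y => f (c + y)) ('D_w f (c + z)).
Proof.
move=> fd; have E : (fun h : R => h^-1 *:
    (((fun y => f (c + y)) \o shift z) (h *: w) - f (c + z))) =
    (fun h : R => h^-1 *: ((f \o shift (c + z)) (h *: w) - f (c + z))).
  by apply/funext => h /=; rewrite addrCA.
by split; rewrite /derivable /derive E.
Qed.

(** Two mean values: along [h *: u] for the increment [g] of [f] by [h *: v], then along [h *: v]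
    for ['D_u f]. *)
Lemma Schwarz_diff f x u v (d : R) :
  (forall y, ball x d y -> derivable f y u /\ derivable ('D_u f) y v) ->
  forall h : R, `|h| * (`|u| + `|v|) < d ->
  exists2 y, `|x - y| <= `|h| * (`|u| + `|v|) &
    f (h *: v + (h *: u + x)) - f (h *: u + x) - (f (h *: v + x) - f x)
    = h ^+ 2 * 'D_v ('D_u f) y.
Proof.
move=> fd h hd.
have inb (s t : R) : 0 <= s <= 1 -> 0 <= t <= 1 ->
    `|x - (s *: (h *: v) + (t *: (h *: u) + x))| <= `|h| * (`|u| + `|v|).
  move=> /andP[s0 s1] /andP[t0 t1]; rewrite addrA opprD addrCA subrr addr0 normrN.
  rewrite (le_trans (ler_normD _ _)) // !normrZ mulrDr addrC lerD //.
    by rewrite (ger0_norm t0) ler_piMl // mulr_ge0.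
  by rewrite (ger0_norm s0) ler_piMl // mulr_ge0.
have inB (s t : R) : 0 <= s <= 1 -> 0 <= t <= 1 ->
    ball x d (s *: (h *: v) + (t *: (h *: u) + x)).
  by move=> s01 t01; rewrite -ball_normE /ball_ /=; apply: le_lt_trans hd; apply: inb.
have i01 : 0 <= (1 : R) <= 1 by rewrite ler01 lexx.
have i00 : 0 <= (0 : R) <= 1 by rewrite ler01 lexx.
pose g y := f (h *: v + y) - f y.
have gd (t : R) : 0 <= t <= 1 ->
  is_derive (t *: (h *: u) + x) (h *: u) (g : U -> R^o)
   (h * ('D_u f (h *: v + (t *: (h *: u) + x)) - 'D_u f (t *: (h *: u) + x))).
  move=> t01.
  have B1 := (fd _ (inB 0 t i00 t01)).1; rewrite scale0r add0r in B1.
  have B2 := (fd _ (inB 1 t i01 t01)).1; rewrite scale1r in B2.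
  have D1 := is_derive_shift_arg (derivableZv (c := h) B2).
  have D2 := derivableP (derivableZv (c := h) B1).
  have [dB eB] := is_deriveB D1 D2; split; first exact: dB.
  apply: (etrans eB); exact: etrans (congr2 (fun y z => y - z) (DvZ h B2) (DvZ h B1)) (esym (mulrBr _ _ _)).
have gd' (t : R) : 0 <= t <= 1 -> derivable g (t *: (h *: u) + x) (h *: u).
  by move=> /gd[].
have [t t01 gE] := line_MVT gd'.
have [s s01 DE] := @line_MVT ('D_u f) (t *: (h *: u) + x) (h *: v)
   (fun s s01 => derivableZv (c := h) (fd _ (inB s t s01 t01)).2).
exists (s *: (h *: v) + (t *: (h *: u) + x)); first exact: inb.
have [_ gD] := gd t t01; rewrite gD DE in gE.
move: gE; rewrite /g => ->.
by rewrite DvZ ?expr2 ?mulrA //; exact: (fd _ (inB s t s01 t01)).2.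
Qed.

Lemma subr_exchange (V : zmodType) (t u v w : V) : t - u - (v - w) = t - v - (u - w).
Proof. by rewrite !opprB addrACA [RHS]addrACA [- u + _]addrC. Qed.

Lemma le_dist_split (y z y' z' e : R) :
  `|y - y'| <= e / 2 -> `|z - z'| <= e / 2 -> y' = z' -> `|y - z| <= e.
Proof.
move=> yy zz E; rewrite -(subrKA y') (splitr e) (le_trans (ler_normD _ _)) // lerD //.
by rewrite E distrC.
Qed.

(** The second difference is symmetric in [u] and [v], so the two mixed derivatives take a common
    value, each at its own point within the same distance of [x]. Continuity of both at [x]
    concludes. *)
Lemma Schwarz f x u v :
  (\forall y \near x, [/\ derivable f y u, derivable f y v,
     derivable ('D_u f) y v & derivable ('D_v f) y u]) ->
  {for x, continuous ('D_v ('D_u f))} -> {for x, continuous ('D_u ('D_v f))} ->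
  'D_v ('D_u f) x = 'D_u ('D_v f) x.
Proof.
move=> /nbhs_ballP[d /= d0 fd] c1 c2.
apply/eqP; rewrite -subr_eq0 -normr_le0; apply/ler_addgt0Pr => e e0; rewrite add0r.
have e20 : 0 < e / 2 by rewrite divr_gt0.
have /cvgrPdist_le/(_ _ e20) := c1 => /nbhs_ballP[d1 /= d10 fd1].
have /cvgrPdist_le/(_ _ e20) := c2 => /nbhs_ballP[d2 /= d20 fd2].
have [h h0 [hd hd1 hd2]] : exists2 h : R, h != 0 & [/\ `|h| * (`|u| + `|v|) < d,
   `|h| * (`|u| + `|v|) < d1 & `|h| * (`|u| + `|v|) < d2].
  pose mm := Num.min d (Num.min d1 d2).
  have mm0 : 0 < mm by rewrite !lt_min d0 d10.
  have K0 : 0 < `|u| + `|v| + 1 by rewrite ltr_wpDl // addr_ge0.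
  exists (mm / (`|u| + `|v| + 1)); first by rewrite gt_eqF // divr_gt0.
  have : `|mm / (`|u| + `|v| + 1)| * (`|u| + `|v|) < mm.
    rewrite ger0_norm ?divr_ge0 ?ltW // mulrAC ltr_pdivrMr //.
    by rewrite ltr_pM2l // ltrDl.
  by rewrite !lt_min => /and3P.
have [||y1 y1x E1] := @Schwarz_diff f x u v d _ h.
- by move=> y /fd[].
- by [].
have [||y2 y2x E2] := @Schwarz_diff f x v u d _ h.
- by move=> y /fd[].
- by rewrite [`|v| + _]addrC.
rewrite [`|v| + _]addrC in y2x.
have E : 'D_v ('D_u f) y1 = 'D_u ('D_v f) y2.
  have h20 : h ^+ 2 != 0 by rewrite expf_neq0.
  apply: (mulfI h20); apply: (etrans (esym E1)); apply: (etrans _ E2).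
  rewrite [h *: u + (h *: v + x)]addrCA.
  exact: subr_exchange.
apply: (le_dist_split _ _ E).
  by apply: fd1; rewrite -ball_normE /ball_ /=; exact: le_lt_trans hd1.
by apply: fd2; rewrite -ball_normE /ball_ /=; exact: le_lt_trans hd2.
Qed.

End DirectionalDerivatives.

(** * Directional derivatives of polynomials *)

Section PolynomialDerivatives.
Context {R : realType} {n : nat}.
Local Notation mp := (mpoly.mpoly n R).
Local Notation homog k := (@mpoly.ishomog1 n R k (mpoly.mpoly_mdeg__canonical__mpoly_Measure n)).
Local Notation "''X_' i" := (mpoly.mpolyX R (mpoly.mnm1 i)) (at level 8, i at level 2).
Implicit Types (p q : mp) (l v : 'rV[R]_n).

Lemma mpoly_alg_ind (P : mp -> Prop) :
  (forall c, P (mpoly.mpolyC n c)) -> (forall i, P 'X_i) ->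
  (forall p q, P p -> P q -> P (p + q)) ->
  (forall p q, P p -> P q -> P (p * q)) -> forall p, P p.
Proof.
move=> PC PX PD PM; elim/mpoly.mpolyind => [|c mm p _ _ IH].
  by rewrite -mpoly.mpolyC0; apply: PC.
apply: PD => //; rewrite -mpoly.mul_mpolyC; apply: (PM) => //.
rewrite mpoly.mpolyXE_id; elim/big_rec: _ => [|i x _ Px].
  by rewrite -mpoly.mpolyC1; apply: PC.
apply: (PM) => //; elim: (mm i) => [|j IHj].
  by rewrite expr0 -mpoly.mpolyC1; apply: PC.
by rewrite exprS; apply: (PM).
Qed.

Definition dd l p : mp := \sum_i l 0 i *: mpoly.mderiv i p.

Lemma dd_is_linear l : linear (dd l).
Proof.
move=> c p q; rewrite /dd scaler_sumr -big_split /=; apply: eq_bigr => i _.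
by rewrite linearP /= scalerDr !scalerA mulrC.
Qed.
HB.instance Definition _ l := GRing.isLinear.Build R mp mp _ (dd l) (dd_is_linear l).

Lemma ddDl l v p : dd (l + v) p = dd l p + dd v p.
Proof.
by rewrite /dd -big_split /=; apply: eq_bigr => i _; rewrite mxE scalerDl.
Qed.

Lemma ddZl c l p : dd (c *: l) p = c *: dd l p.
Proof. by rewrite /dd scaler_sumr; apply: eq_bigr => i _; rewrite mxE scalerA. Qed.

Lemma dd0l p : dd 0 p = 0.
Proof. by rewrite -(scale0r (0 : 'rV[R]_n)) ddZl scale0r. Qed.

Lemma dd_suml (I : Type) (r : seq I) (P : pred I) (F : I -> 'rV[R]_n) p :
  dd (\sum_(i <- r | P i) F i) p = \sum_(i <- r | P i) dd (F i) p.
Proof. by elim/big_rec2: _ => [|i x y _ <-]; rewrite ?dd0l ?ddDl. Qed.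

Lemma dd_delta i p : dd (delta_mx 0 i) p = mpoly.mderiv i p.
Proof.
rewrite /dd (bigD1 i) //= mxE !eqxx scale1r big1 ?addr0 // => j ji.
by rewrite mxE (negPf ji) andbF scale0r.
Qed.

Lemma ddM l p q : dd l (p * q) = dd l p * q + p * dd l q.
Proof.
rewrite /dd mulr_suml mulr_sumr -big_split /=; apply: eq_bigr => i _.
by rewrite mpoly.mderivM scalerDr scalerAl scalerAr.
Qed.

Lemma ddC l c : dd l (mpoly.mpolyC n c) = 0.
Proof. by rewrite /dd big1 // => i _; rewrite mpoly.mderivC scaler0. Qed.

Lemma ddXi l i : dd l 'X_i = mpoly.mpolyC n (l 0 i).
Proof.
rewrite /dd (bigD1 i) //= big1 ?addr0 => [|j ji].
  rewrite mpoly.mderivX mpoly.mnm1E eqxx scale1r.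
  have -> : mpoly.mnm_sub (mpoly.mnm1 i) (mpoly.mnm1 i) = mpoly.mnm0.
    by apply/mpoly.mnmP => x; rewrite mpoly.mnmBE subnn mpoly.mnm0E.
  by rewrite mpoly.mpolyX0 -mpoly.mul_mpolyC mulr1.
by rewrite mpoly.mderivX mpoly.mnm1E eq_sym (negPf ji) scale0r scaler0.
Qed.

Lemma mderiv_homog k i p : p \is homog k.+1 -> mpoly.mderiv i p \is homog k.
Proof.
move=> hp; apply/mpoly.dhomogP => mm; rewrite mpoly.mcoeff_msupp mpoly.mcoeff_deriv.
apply: contra_neq_eq => hmm.
rewrite (mpoly.dhomog_nemf_coeff hp) ?mul0rn //.
by rewrite /= mpoly.mdegD mpoly.mdeg1 addn1 eqSS.
Qed.

Lemma dd_homog k l p : p \is homog k.+1 -> dd l p \is homog k.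
Proof.
by move=> hp; rewrite rpred_sum // => i _; apply/rpredZ/mderiv_homog.
Qed.

Lemma homog0C p x : p \is homog 0 -> p = mpoly.mpolyC n (mpoly.meval x p).
Proof.
move=> hp; suff E : p = mpoly.mpolyC n (mpoly.mcoeff (mpoly.mnm0 (n := n)) p).
  by rewrite {2}E mpoly.mevalC.
apply/mpoly.mpolyP => mm; rewrite mpoly.mcoeffC.
have [->|m0] := eqVneq mm (mpoly.mnm0 (n := n)); first by rewrite mulr1.
by rewrite mulr0 (mpoly.dhomog_nemf_coeff hp) // mpoly.mdeg_eq0.
Qed.

Lemma dd_homog0 l p : p \is homog 0 -> dd l p = 0.
Proof. by move=> /(homog0C (fun=> 0)) ->; rewrite ddC. Qed.

Lemma euler k p : p \is homog k -> \sum_i 'X_i * mpoly.mderiv i p = k%:R *: p.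
Proof.
move=> hp; rewrite [in LHS](mpoly.mpolyE p) [in RHS](mpoly.mpolyE p).
rewrite scaler_sumr; under eq_bigr do rewrite linear_sum mulr_sumr.
rewrite exchange_big /= big_seq [RHS]big_seq; apply: eq_bigr => mm mp_.
have kE : mpoly.mdeg mm = k by apply: (mpoly.dhomog_mf hp).
under eq_bigr do rewrite linearZ /= mpoly.mderivX -scalerAr -scalerAr.
rewrite -scaler_sumr scalerA mulrC -scalerA; congr (_ *: _).
rewrite -kE mpoly.mdegE natr_sum scaler_suml; apply: eq_bigr => i _.
(* For [mm i = 0] the exponent subtraction is truncated, but the coefficient is zero. *)
have [->|mi] := eqVneq (mm i) 0%N; first by rewrite !scale0r.
congr (_ *: _); rewrite -mpoly.mpolyXD; congr mpoly.mpolyX.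
apply/mpoly.mnmP => j; rewrite mpoly.mnmDE mpoly.mnmBE mpoly.mnm1E.
by have [<-|] := eqVneq i j; rewrite ?subn0 //= subnKC // lt0n.
Qed.

Lemma homogS_meval0 k p : p \is homog k.+1 -> mpoly.meval (fun=> 0) p = 0.
Proof.
move=> hp; apply: (@mulfI _ k.+1%:R); first by rewrite pnatr_eq0.
rewrite mulr0 -mpoly.mevalZ -euler // linear_sum big1 // => i _.
by rewrite /= mpoly.mevalM mpoly.mevalXU mul0r.
Qed.

Lemma mderiv_dd i l p : mpoly.mderiv i (dd l p) = dd l (mpoly.mderiv i p).
Proof.
rewrite /dd linear_sum; apply: eq_bigr => j _.
by rewrite linearZ /= mpoly.mderiv_comm.
Qed.

Lemma dd_comm l v p : dd l (dd v p) = dd v (dd l p).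
Proof.
rewrite [RHS]linear_sum; apply: eq_bigr => i _.
by rewrite linearZ /= mderiv_dd.
Qed.

(** The algebraic counterpart of [partials], with words read in the same order. *)
Definition ders (u : seq 'I_n) p : mp := foldr (@mpoly.mderiv n R) p u.

Lemma ders_is_linear u : linear (ders u).
Proof. by move=> c p q; elim: u => //= i u ->; rewrite linearP. Qed.
HB.instance Definition _ u := GRing.isLinear.Build R mp mp _ (ders u) (ders_is_linear u).

Lemma ders_mderiv u i p : ders u (mpoly.mderiv i p) = mpoly.mderiv i (ders u p).
Proof. by elim: u => //= j u ->; rewrite mpoly.mderiv_comm. Qed.

Lemma ders_dd u l p : ders u (dd l p) = dd l (ders u p).
Proof.
by rewrite /dd linear_sum; apply: eq_bigr => i _; rewrite linearZ /= ders_mderiv.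
Qed.

Lemma ders_homog k u p : p \is homog (size u + k)%N -> ders u p \is homog k.
Proof.
elim: u p => //= i u IH p hp; rewrite -ders_mderiv; apply: IH.
exact: mderiv_homog.
Qed.

(** By Euler's identity a homogeneous polynomial of positive degree vanishes once its first
    derivatives do. Hence it is determined by the array of its derivatives of top order, which is
    how polynomials are compared with jets. *)
Lemma ders_eq0 k p : p \is homog k ->
  (forall u, size u = k -> mpoly.meval (fun=> 0) (ders u p) = 0) -> p = 0.
Proof.
elim: k p => [|k IH] p hp p0.
  by rewrite (homog0C (fun=> 0) hp) (p0 [::]) // mpoly.mpolyC0.
have dp i : mpoly.mderiv i p = 0.
  apply: IH => [|u su]; first exact: mderiv_homog.
  by rewrite ders_mderiv; apply: (p0 (i :: u)); rewrite /= su.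
have k0 : k.+1%:R != 0 :> R by rewrite pnatr_eq0.
apply: (scalerI k0); rewrite -euler // scaler0 big1 // => i _.
by rewrite dp mulr0.
Qed.

Lemma linear_form_homog (c : 'I_n -> R) : \sum_i c i *: 'X_i \is homog 1.
Proof.
rewrite rpred_sum // => i _; apply: rpredZ.
by rewrite mpoly.dhomogX /= mpoly.mdeg1.
Qed.

Lemma dd_linear_form (c : 'I_n -> R) l :
  dd l (\sum_i c i *: 'X_i) = mpoly.mpolyC n (\sum_i c i * l 0 i).
Proof.
rewrite linear_sum /= (raddf_sum (@mpoly.mpolyC n R)); apply: eq_bigr => i _.
by rewrite linearZ /= ddXi -mpoly.mul_mpolyC -mpoly.mpolyCM.
Qed.

(** The form is the coordinate along [l] in the free family made of [l] and a basis of [b], extended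
    linearly to the whole space. *)
Lemma dual_form (b : {vspace 'rV[R]_n}) l : l \notin b -> exists xi : mp,
  [/\ xi \is homog 1, dd l xi = 1 & forall v, v \in b -> dd v xi = 0].
Proof.
move=> lb; pose X := [tuple of l :: vbasis b].
have frX : free X.
  rewrite /X /= free_cons (basis_free (vbasisP b)) andbT.
  by rewrite (span_basis (vbasisP b)).
pose phi v : R := coord X ord0 v.
have phiE v : phi v = \sum_i phi (delta_mx 0 i) * v 0 i.
  rewrite {1}(row_sum_delta v) /phi linear_sum; apply: eq_bigr => i _.
  by rewrite linearZ /= mulrC.
exists (\sum_i phi (delta_mx 0 i) *: 'X_i); split.
- exact: linear_form_homog.
- rewrite dd_linear_form -phiE /phi.
  by rewrite (_ : l = X`_(@ord0 (\dim b))) // coord_free // mpoly.mpolyC1.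
move=> v vb; rewrite dd_linear_form -phiE.
rewrite (coord_vbasis vb) /phi linear_sum big1 ?mpoly.mpolyC0 // => i _.
rewrite linearZ /= (_ : (vbasis b)`_i = X`_(lift ord0 i)) // coord_free //.
by rewrite mulr0.
Qed.

(** The form [xi] plays the role of the integration variable: its derivative is 1 along [l] and 0
    along [b]. The weight [xi ^+ j] is there for the induction on the degree of [p], since lowering
    that degree raises the power of [xi]. *)
Lemma antiderivative (b : {vspace 'rV[R]_n}) l k p : l \notin b ->
  p \is homog k -> (forall v, v \in b -> dd v p = 0) ->
  exists w, [/\ w \is homog k.+1, dd l w = p & forall v, v \in b -> dd v w = 0].
Proof.
move=> /dual_form[xi [hxi lxi bxi]].
(* Integration by parts: if [w] integrates [xi ^+ j.+1 * dd l p], then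
   [(xi ^+ j.+1 * p - w) / j.+1] integrates [xi ^+ j * p]. *)
suff H j : p \is homog k -> (forall v, v \in b -> dd v p = 0) ->
    exists w, [/\ w \is homog (k + j).+1, dd l w = xi ^+ j * p &
      forall v, v \in b -> dd v w = 0].
  by move=> hp bp; have := H 0%N hp bp; rewrite addn0 mul1r.
have xiX i : xi ^+ i \is homog i.
  by have := mpoly.dhomogMn i hxi; rewrite mul1n.
have ddX v i : dd v (xi ^+ i.+1) = i.+1%:R *: (dd v xi * xi ^+ i).
  elim: i => [|i IH]; first by rewrite expr1 expr0 mulr1 scale1r.
  rewrite exprS ddM IH -scalerAr mulrCA -exprS -[X in X + _]scale1r -scalerDl.
  by rewrite addrC natr1.
elim: k j p => [|k IH] j p hp bp.
  exists (j.+1%:R^-1 *: (xi ^+ j.+1 * p)); split.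
  - by rewrite add0n; apply: rpredZ; have := mpoly.dhomogM (xiX j.+1) hp; rewrite addn0.
  - rewrite linearZ /= ddM (dd_homog0 l hp) mulr0 addr0 ddX lxi mul1r -scalerAl scalerA.
    by rewrite mulVf ?scale1r // pnatr_eq0.
  move=> v vb; rewrite linearZ /= ddM (dd_homog0 v hp) mulr0 addr0 ddX bxi //.
  by rewrite mul0r scaler0 mul0r scaler0.
have [||w [hw lw bw]] := IH j.+1 (dd l p).
- exact: dd_homog.
- by move=> v vb; rewrite dd_comm bp // linear0.
exists (j.+1%:R^-1 *: (xi ^+ j.+1 * p - w)); split.
- apply/rpredZ/rpredB; last by rewrite addSnnS.
  by have := mpoly.dhomogM (xiX j.+1) hp; rewrite addnC addnS.
- rewrite linearZ linearB /= ddM lw addrK ddX lxi mul1r -scalerAl scalerA.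
  by rewrite mulVf ?scale1r // pnatr_eq0.
move=> v vb; rewrite linearZ linearB /= ddM bp // mulr0 addr0 bw // subr0 ddX bxi //.
by rewrite mul0r scaler0 mul0r scaler0.
Qed.

End PolynomialDerivatives.

(** * The Poincare lemma, and polynomials with prescribed derivatives *)

Section PolynomialIntegration.
Context {R : realType} {n : nat}.
Local Notation mp := (mpoly.mpoly n R).
Local Notation homog k := (@mpoly.ishomog1 n R k (mpoly.mpoly_mdeg__canonical__mpoly_Measure n)).
Local Notation "''X_' i" := (mpoly.mpolyX R (mpoly.mnm1 i)) (at level 8, i at level 2).
Implicit Types (p q : mp) (l v : 'rV[R]_n).

(** A solution [w0] for the tail of the list is corrected by an antiderivative of [p - dd l w0]
    along [l]. The compatibility conditions say that this error is killed by the tail, so the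
    correction can be taken constant along it and spoils nothing. *)
Lemma poincare k (bs : seq ('rV[R]_n * mp)) : free [seq x.1 | x <- bs] ->
  (forall x, x \in bs -> x.2 \is homog k) ->
  (forall x y, x \in bs -> y \in bs -> dd x.1 y.2 = dd y.1 x.2) ->
  exists2 w : mp, w \is homog k.+1 & forall x, x \in bs -> dd x.1 w = x.2.
Proof.
elim: bs => [|[l p] bs IH] /= fr hh comp; first by exists 0; rewrite ?rpred0.
move: fr; rewrite free_cons => /andP[lb fr].
have [|x y xbs ybs|w0 hw0 w0E] := IH fr.
- by move=> x xbs; apply: hh; rewrite inE xbs orbT.
- by apply: comp; rewrite inE ?xbs ?ybs orbT.
have hp : p \is homog k by apply: (hh (l, p)); rewrite mem_head.
have [||w' [hw' lw' bw']] := antiderivative (p := p - dd l w0) (k := k) lb.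
- by apply: rpredB => //; apply: dd_homog.
- move=> v vb; rewrite (coord_span (X := in_tuple _) vb) dd_suml big1 // => i _; rewrite ddZl.
  set X := in_tuple _; have vX : X`_i \in [seq x.1 | x <- bs].
    by apply: mem_nth; rewrite ltn_ord.
  have /mapP[x xbs ->] := vX.
  rewrite linearB /= dd_comm w0E // (comp x (l, p)) ?subrr ?scaler0 //.
    by rewrite inE xbs orbT.
  by rewrite mem_head.
exists (w0 + w') => [|x]; first exact: rpredD.
rewrite inE => /orP[/eqP ->/=|xbs]; first by rewrite linearD /= lw' addrC subrK.
rewrite linearD /= w0E // bw' ?addr0 //; apply: memv_span.
by apply/mapP; exists x.
Qed.

(* For symmetric [T], this is [k`!] times the polynomial whose derivative along
   each word [u] of length [k] is [T u]. *)
Fixpoint poly_of_words k (T : seq 'I_n -> R) : mp :=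
  if k is k'.+1 then \sum_j 'X_j * poly_of_words k' (fun u => T (j :: u))
  else mpoly.mpolyC n (T [::]).

(** Adjacent transpositions generate all permutations of a word, and they are the form in which the
    symmetry of partial derivatives is available. *)
Definition sym_words (T : seq 'I_n -> R) :=
  forall u t i j, T (u ++ i :: j :: t) = T (u ++ j :: i :: t).

Lemma poly_of_words_homog k T : poly_of_words k T \is homog k.
Proof.
elim: k T => [|k IH] T /=.
  rewrite -[X in X \is _]mulr1 mpoly.mul_mpolyC.
  by apply: rpredZ; apply: mpoly.dhomog1.
rewrite rpred_sum // => j _; rewrite -add1n; apply: mpoly.dhomogM => //.
by rewrite mpoly.dhomogX /= mpoly.mdeg1.
Qed.

Lemma eq_poly_of_words k T T' : T =1 T' -> poly_of_words k T = poly_of_words k T'.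
Proof.
elim: k T T' => [|k IH] T T' TT /=; first by rewrite TT.
by apply: eq_bigr => j _; congr (_ * _); apply: IH => u.
Qed.

Lemma poly_of_wordsS k T : poly_of_words k.+1 T =
  \sum_j 'X_j * poly_of_words k (fun u => T (j :: u)).
Proof. by []. Qed.
Arguments poly_of_words : simpl never.

(** By the product rule the variable of index [i] contributes one copy; the induction hypothesis
    contributes the others, once the two leading letters are exchanged. *)
Lemma mderiv_poly_of_words k T i : sym_words T ->
  mpoly.mderiv i (poly_of_words k.+1 T) =
  k.+1%:R *: poly_of_words k (fun u => T (i :: u)).
Proof.
have E j p : mpoly.mderiv i ('X_j * p) =
    (j == i)%:R *: p + 'X_j * mpoly.mderiv i p.
  rewrite mpoly.mderivM -dd_delta ddXi mxE eqxx -mpoly.mul_mpolyC.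
  by [].
have S F : \sum_j (j == i)%:R *: F j = F i :> mp.
  rewrite (bigD1 i) //= eqxx scale1r big1 ?addr0 // => j /negPf ->.
  by rewrite scale0r.
elim: k T => [|k IH] T sT.
  rewrite poly_of_wordsS linear_sum /=.
  under eq_bigr do rewrite E // mpoly.mderivC mulr0 addr0.
  by rewrite S scale1r.
rewrite poly_of_wordsS linear_sum /=; under eq_bigr => j _.
  rewrite E // IH; last by move=> u v a b; apply: (sT (j :: u)).
  over.
rewrite big_split /= S -[k.+2%:R]/(1 + k.+1)%:R natrD scalerDl scale1r.
congr (_ + _); rewrite scaler_sumr; apply: eq_bigr => j _.
rewrite -scalerAr; congr (_ *: (_ * _)); apply: eq_poly_of_words => u.
exact: (sT [::]).
Qed.

Lemma words_poly k T : sym_words T -> exists2 p : mp, p \is homog k &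
  forall u, size u = k -> mpoly.meval (fun=> 0) (ders u p) = T u.
Proof.
move=> sT; exists (k`!%:R^-1 *: poly_of_words k T).
  by apply: rpredZ; apply: poly_of_words_homog.
move=> u su; rewrite linearZ /= mpoly.mevalZ.
suff -> : mpoly.meval (fun=> 0) (ders u (poly_of_words k T)) = k`!%:R * T u.
  by rewrite mulrA mulVf ?mul1r // pnatr_eq0 -lt0n fact_gt0.
elim: k u T sT su => [|k IH] [|i u] // T sT su.
  by rewrite /poly_of_words /= mpoly.mevalC mul1r.
rewrite [ders _ _]/= -ders_mderiv mderiv_poly_of_words // linearZ /= mpoly.mevalZ.
rewrite IH ?factS ?natrM ?mulrA //; last by case: su.
by move=> u' v' a b; apply: (sT (i :: u')).
Qed.

Lemma meval_derive a p (x v : 'rV[R]_n) :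
  continuous (fun y : 'rV[R]_n => mpoly.meval ((y - a) 0) p : R^o) /\
  is_derive x v (fun y : 'rV[R]_n => mpoly.meval ((y - a) 0) p : R^o)
    (mpoly.meval ((x - a) 0) (dd v p)).
Proof.
elim/(@mpoly_alg_ind R n): p x => [c|i|p q IHp IHq|p q IHp IHq] x.
- under eq_fun do rewrite mpoly.mevalC.
  split; first exact: cst_continuous.
  by rewrite ddC mpoly.mevalC; apply: is_derive_cst.
- under eq_fun do rewrite mpoly.mevalXU 2!mxE.
  rewrite ddXi mpoly.mevalC; split=> [y|].
    apply: (@continuousD _ R^o _ (fun y : 'rV[R]_n => y 0 i) (cst (- a 0 i))).
      exact: coord_continuous.
    exact: cst_continuous.
  have := is_deriveD (is_derive_coord 0 i x v) (is_derive_cst (- a 0 i : R^o) x v).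
  by rewrite addr0.
- have [cp dp] := IHp x; have [cq dq] := IHq x.
  under eq_fun do rewrite mpoly.mevalD.
  split; first by move=> y; exact: (continuousD (cp y) (cq y)).
  by rewrite linearD mpoly.mevalD; exact: (is_deriveD dp dq).
have [cp dp] := IHp x; have [cq dq] := IHq x.
under eq_fun do rewrite mpoly.mevalM.
split; first by move=> y; exact: (continuousM (cp y) (cq y)).
rewrite ddM mpoly.mevalD !mpoly.mevalM addrC [X in _ + X]mulrC.
exact: (is_deriveM dp dq).
Qed.

End PolynomialIntegration.

(** * Powers of the ideal of a subspace *)

Section IdealPowers.
Context {S : comNzRingType}.
Implicit Types (J : set S) (p q r : S).

Lemma ideal_exp0 J p : ideal_exp J 0 p.
Proof.
exists 1%N, (fun=> p), (fun _ j => p); split; first by move=> i [].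
by rewrite big_ord1 big_ord0 mulr1.
Qed.

Lemma ideal_exp_zero J k : ideal_exp J k 0.
Proof. by exists 0%N, (fun=> 0), (fun _ _ => 0); split; [case|rewrite big_ord0]. Qed.

Lemma ideal_expD J k p q : ideal_exp J k p -> ideal_exp J k q -> ideal_exp J k (p + q).
Proof.
move=> [N1 [c1 [q1 [J1 ->]]]] [N2 [c2 [q2 [J2 ->]]]].
exists (N1 + N2)%N, (fun i => match fintype.split i with inl a => c1 a | inr b => c2 b end),
  (fun i => match fintype.split i with inl a => q1 a | inr b => q2 b end); split.
  by move=> i j; case: (fintype.split i) => a; [apply: J1|apply: J2].
rewrite big_split_ord /=; congr (_ + _); apply: eq_bigr => i _.
  by rewrite (unsplitK (inl i)).
by rewrite (unsplitK (inr i)).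
Qed.

Lemma ideal_expMl J k r p : ideal_exp J k p -> ideal_exp J k (r * p).
Proof.
move=> [N [c [q [Jq ->]]]]; exists N, (fun i => r * c i), q; split=> //.
by rewrite mulr_sumr; apply: eq_bigr => i _; rewrite mulrA.
Qed.

Lemma ideal_expM J k q p : J q -> ideal_exp J k p -> ideal_exp J k.+1 (q * p).
Proof.
move=> Jq [N [c [q' [Jq' ->]]]].
exists N, c, (fun i j => if unlift ord0 j is Some j' then q' i j' else q); split.
  by move=> i j; case: unliftP.
rewrite mulr_sumr; apply: eq_bigr => i _; rewrite big_ord_recl unlift_none.
by rewrite mulrCA; congr (_ * (_ * _)); apply: eq_bigr => j _; rewrite liftK.
Qed.

Lemma ideal_exp_sum J k (I : Type) (s : seq I) (P : pred I) (F : I -> S) :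
  (forall i, P i -> ideal_exp J k (F i)) -> ideal_exp J k (\sum_(i <- s | P i) F i).
Proof.
move=> JF; elim/big_ind: _ => [|x y|//]; first exact: ideal_exp_zero.
exact: ideal_expD.
Qed.

Lemma ideal_expS J k p : ideal_exp J k.+1 p -> exists N (q r : 'I_N -> S),
  [/\ forall i, J (q i), forall i, ideal_exp J k (r i) & p = \sum_i q i * r i].
Proof.
move=> [N [c [q [Jq ->]]]].
exists N, (fun i => q i ord0), (fun i => c i * \prod_j q i (lift ord0 j)); split.
- by move=> i; apply: Jq.
- move=> i; exists 1%N, (fun=> c i), (fun _ j => q i (lift ord0 j)).
  by split=> //; rewrite big_ord1.
by apply: eq_bigr => i _; rewrite big_ord_recl mulrCA.
Qed.

End IdealPowers.

(** * Homogeneous polynomials in the powers of the ideal of a subspace *)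

Section VanishingIdeal.
Context {R : realType} {n : nat}.
Local Notation mp := (mpoly.mpoly n R).
Local Notation homog k := (@mpoly.ishomog1 n R k (mpoly.mpoly_mdeg__canonical__mpoly_Measure n)).
Local Notation "''X_' i" := (mpoly.mpolyX R (mpoly.mnm1 i)) (at level 8, i at level 2).
Implicit Types (p q : mp) (l v : 'rV[R]_n) (b : {vspace 'rV[R]_n}).

(** At a point of [b], the difference quotients along a direction of [b] only involve values on [b],
    all zero. *)
Lemma vanishing_dd b l q : l \in b -> vanishing_ideal b q -> vanishing_ideal b (dd l q).
Proof.
move=> lb q0 x xb; have [_ [_ D]] := meval_derive 0 q x l.
rewrite subr0 in D; rewrite -D /derive.
rewrite (_ : (fun h => _) = (fun=> 0 : R^o)) ?lim_cst //.
apply/funext => h /=; rewrite !subr0 !q0 // ?subr0 ?scaler0 //.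
by apply: rpredD => //; apply: rpredZ.
Qed.

Lemma ideal_exp_dd b k v p : ideal_exp (vanishing_ideal b) k.+1 p ->
  ideal_exp (vanishing_ideal b) k (dd v p).
Proof.
elim: k p => [|k IH] p; first by move=> _; apply: ideal_exp0.
move=> /ideal_expS[N [q [r [Jq Jr ->]]]].
rewrite linear_sum; apply: ideal_exp_sum => i _; rewrite /= ddM.
apply: ideal_expD; first exact: ideal_expMl.
by apply: ideal_expM => //; apply: IH.
Qed.

Lemma ideal_exp_dd_in b k l p : l \in b -> ideal_exp (vanishing_ideal b) k p ->
  ideal_exp (vanishing_ideal b) k (dd l p).
Proof.
move=> lb; elim: k p => [|k IH] p; first by move=> _; apply: ideal_exp0.
move=> /ideal_expS[N [q [r [Jq Jr ->]]]].
rewrite linear_sum; apply: ideal_exp_sum => i _; rewrite /= ddM.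
apply: ideal_expD; first by apply: ideal_expM => //; apply: vanishing_dd.
by apply: ideal_expM => //; apply: IH.
Qed.

Lemma ideal_exp_ders b k u p :
  ideal_exp (vanishing_ideal b) (size u + k) p ->
  ideal_exp (vanishing_ideal b) k (ders u p).
Proof.
elim: u p => //= i u IH p Jp; rewrite -ders_mderiv; apply: IH.
by rewrite -dd_delta; apply: ideal_exp_dd.
Qed.

(** A derivative along [b] preserves the powers of the ideal, while an arbitrary one lowers the
    exponent by one. So if [p] is in the [k]-th power, the derivatives of order [k - 1] of [dd l p]
    are in the ideal itself and vanish at the origin; as [dd l p] has degree [k - 1], it is zero. *)
Lemma ideal_exp_homogP b k p : p \is homog k ->
  ideal_exp (vanishing_ideal b) k p <-> forall l, l \in b -> dd l p = 0.
Proof.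
move=> hp; split=> [Jp l lb|].
  case: k hp Jp => [|k] hp Jp; first exact: dd_homog0.
  apply: (ders_eq0 (dd_homog l hp)) => u su.
  have : ideal_exp (vanishing_ideal b) 1 (ders u (dd l p)).
    by apply: ideal_exp_ders; rewrite su addn1; apply: ideal_exp_dd_in.
  move=> /ideal_expS[N [q [r [Jq _ ->]]]].
  rewrite linear_sum big1 // => i _ /=; rewrite mpoly.mevalM.
  have := Jq i 0 (mem0v _); rewrite (@mpoly.meval_eq _ _ _ (fun=> 0)).
    by move=> ->; rewrite mul0r.
  by move=> j; rewrite mxE.
elim: k p hp => [|k IH] p hp bp; first exact: ideal_exp0.
(* Euler's identity, in which the coordinates ['X_j] may be replaced by linear
   forms [lam j] vanishing on [b], since [b] kills [p]. *)
pose P v := v - projv b v.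
pose lam j : mp := \sum_i P (delta_mx 0 i) 0 j *: 'X_i.
have PE x : P x = \sum_i x 0 i *: P (delta_mx 0 i).
  rewrite {1}(row_sum_delta x) /P linear_sum -sumrB; apply: eq_bigr => i _.
  by rewrite linearZ -scalerBr.
have Jlam j : vanishing_ideal b (lam j).
  move=> x xb; rewrite linear_sum /=.
  transitivity (P x 0 j); last by rewrite /P projv_id // subrr mxE.
  rewrite PE summxE; apply: eq_bigr => i _.
  by rewrite [RHS]mxE /= mpoly.mevalZ mpoly.mevalXU mulrC.
have E : k.+1%:R *: p = \sum_j lam j * mpoly.mderiv j p.
  rewrite -euler //; under [RHS]eq_bigr do rewrite mulr_suml.
  rewrite exchange_big /=; apply: eq_bigr => i _.
  under [RHS]eq_bigr do rewrite -scalerAl scalerAr.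
  rewrite -mulr_sumr -/(dd _ _); congr (_ * _).
  rewrite -dd_delta /P -[RHS]addr0 -(bp _ (memv_proj b (delta_mx 0 i))).
  by rewrite -ddDl subrK.
have k0 : k.+1%:R != 0 :> R by rewrite pnatr_eq0.
rewrite -[p](scalerK k0) E -mpoly.mul_mpolyC; apply: ideal_expMl.
apply: ideal_exp_sum => j _; apply: ideal_expM => //; apply: IH.
  exact: mderiv_homog.
by move=> l lb; rewrite -mderiv_dd bp // linear0.
Qed.

End VanishingIdeal.

(** * Vector-valued polynomials and the constant rank of the model bundle *)

Section VectorValued.
Context {R : realType} {n m : nat}.
Local Notation W k := (homog_poly R n m k).

Definition ddh k (l : 'rV[R]_n) (w : mpoly.dhomog n R k.+1) : mpoly.dhomog n R k :=
  mpoly.DHomog (dd_homog l (mpoly.dhomog_is_dhomog w)).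

Definition ddw k (l : 'rV[R]_n) (w : W k.+1) : W k := [ffun j => ddh l (w j)].

Lemma ddw_is_linear k l : linear (@ddw k l).
Proof.
move=> c w w'; apply/ffunP => j; rewrite !ffunE; apply: val_inj.
by rewrite /= linearP.
Qed.
HB.instance Definition _ k l := GRing.isLinear.Build R (W k.+1) (W k) _ (@ddw k l)
  (@ddw_is_linear k l).

Lemma model_kernelP k (b : {vspace 'rV[R]_n}) (w : W k) :
  model_kernel n m k b w <-> forall l, l \in b -> forall j, dd l (w j) = 0.
Proof.
split=> [Kw l lb j|Kw j].
  exact: (ideal_exp_homogP b (mpoly.dhomog_is_dhomog (w j))).1 (Kw j) l lb.
by apply/(ideal_exp_homogP b (mpoly.dhomog_is_dhomog (w j))) => l lb; apply: Kw.
Qed.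

End VectorValued.

(** The family is a basis of a complement of [K0]. Any [K] of the same dimension whose intersection
    with its span is trivial is again a complement of that span, by counting dimensions. *)
Lemma complement_frame (F : fieldType) (V : vectType F) d (K0 : {vspace V}) :
  \dim K0 = d -> exists e : 'I_(\dim {:V} - d) -> V,
    (forall z : 'rV[F]_(\dim {:V} - d), \sum_i z 0 i *: e i \in K0 -> z = 0) /\
    forall K : {vspace V}, \dim K = d ->
      (forall z : 'rV[F]_(\dim {:V} - d), \sum_i z 0 i *: e i \in K -> z = 0) ->
      forall w, exists z : 'rV[F]_(\dim {:V} - d), w - \sum_i z 0 i *: e i \in K.
Proof.
move=> dK0.
have sz : size (vbasis K0^C) == (\dim {:V} - d)%N.
  by rewrite size_tuple dimv_compl dK0.
pose X := Tuple sz.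
have frX : free X by rewrite /X /= (basis_free (vbasisP _)).
have Xmem (i : 'I_(\dim {:V} - d)) : X`_i \in (K0^C)%VS.
  by apply: vbasis_mem; rewrite -(tnth_nth 0 X i); exact: (mem_tnth i X).
exists (fun i => X`_i); split=> [z zK|K dK ind w].
  have zX : \sum_i z 0 i *: X`_i = 0.
    apply/eqP; rewrite -memv0 -(capv_compl K0) memv_cap zK /=.
    by apply: memv_suml => i _; apply: memvZ; apply: Xmem.
  have /freeP/(_ (fun i => z 0 i) zX) z0 := frX.
  by apply/rowP => i; rewrite mxE z0.
have dX : \dim <<X>> = (\dim {:V} - d)%N by move/eqP: frX; rewrite size_tuple.
have cap0 : (<<X>> :&: K)%VS = 0%VS.
  apply/eqP; rewrite -subv0; apply/subvP => v; rewrite memv_cap => /andP[vX].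
  rewrite (coord_span vX) => vK.
  pose z : 'rV[F]_(\dim {:V} - d) := \row_i coord X i v.
  have z0 : z = 0.
    apply: ind; suff -> : \sum_i z 0 i *: X`_i = \sum_i coord X i v *: X`_i by [].
    by apply: eq_bigr => i _; rewrite mxE.
  rewrite big1 ?mem0v // => i _.
  by have /rowP/(_ i) := z0; rewrite !mxE => ->; rewrite scale0r.
have full : (<<X>> + K)%VS = fullv.
  apply/eqP; rewrite eqEdim subvf /= dimv_disjoint_sum // dX dK subnK //.
  by rewrite -dK dimvS // subvf.
have /memv_addP[u uX [v vK wE]] : w \in (<<X>> + K)%VS by rewrite full memvf.
exists (\row_i coord X i u); rewrite wE {1}(coord_span uX).
under [X in _ - X]eq_bigr do rewrite mxE.
by rewrite addrAC subrr add0r.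
Qed.

Section KernelRank.
Context {R : realType} {n m : nat}.
Local Notation L := 'rV[R]_n.+1.
Local Notation W k := (homog_poly R n.+1 m k).
Implicit Types (b : {vspace L}) (l : L).

Definition killed k b (w : W k) := forall l, l \in b -> forall j, dd l (w j) = 0.

Lemma vspace_split s b : \dim b = s.+1 ->
  exists b' l, [/\ \dim b' = s, l \notin b' & b = (<[l]> + b')%VS].
Proof.
move=> db; have := vbasisP b; move: (vbasis b); rewrite db => Y; case/tupleP: Y => l X bX.
exists <<X>>%VS, l.
have := basis_free bX; rewrite /= free_cons => /andP[lX fX].
split=> //; first by move/eqP: fX; rewrite size_tuple.
by rewrite -(span_basis bX) span_cons.
Qed.

(* [ddw l] maps the polynomials of degree [k.+1] killed by [b'] onto those of
   degree [k], and its kernel is killed by [b' + <[l]>]; hence the dimension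
   depends only on [k] and on that of [b]. *)
Lemma killed_dim s k : exists d, forall b, \dim b = s ->
  exists2 K : {vspace W k}, (forall w, w \in K <-> killed b w) & \dim K = d.
Proof.
elim: s k => [|s IH] k.
  exists (\dim {:W k}) => b /eqP; rewrite dimv_eq0 => /eqP ->.
  exists fullv => // w; rewrite memvf; split=> // _ l; rewrite memv0 => /eqP -> j.
  exact: dd0l.
case: k => [|k].
  exists (\dim {:W 0}) => b _; exists fullv => // w; rewrite memvf; split=> // _ l _ j.
  exact/dd_homog0/mpoly.dhomog_is_dhomog.
have [d1 D1] := IH k.+1; have [d0 D0] := IH k.
exists (d1 - d0)%N => b /vspace_split[b' [l [db' lb' ->]]].
have [K1 K1P dK1] := D1 _ db'; have [K0 K0P dK0] := D0 _ db'.
have lE w : linfun (@ddw R n.+1 m k l) w = ddw l w by rewrite lfunE.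
exists (K1 :&: lker (linfun (@ddw R n.+1 m k l)))%VS.
  move=> w; rewrite memv_cap memv_ker lE; split=> [/andP[/K1P wb' /eqP wl]|wk].
    move=> _ /memv_addP[_ /vlineP[c ->] [v vb' ->]] j.
    rewrite ddDl ddZl (wb' v vb') addr0.
    have /ffunP/(_ j) := wl; rewrite !ffunE => /(congr1 val) /= ->.
    by rewrite scaler0.
  apply/andP; split.
    by apply/K1P => v vb' j; apply: wk; apply: subvP vb'; apply: addvSr.
  apply/eqP/ffunP => j; rewrite !ffunE; apply: val_inj => /=; apply: wk.
  by apply: subvP (memv_line l); apply: addvSl.
have := limg_ker_dim (linfun (@ddw R n.+1 m k l)) K1.
suff -> : (linfun (@ddw R n.+1 m k l) @: K1)%VS = K0.
  by rewrite dK1 dK0 => <-; rewrite addnK.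
apply/vspaceP => w; apply/memv_imgP/idP => [[w1 /K1P w1b ->]|/K0P wb].
  apply/K0P => v vb j; by rewrite lE !ffunE /= dd_comm w1b // linear0.
have H j : exists w1 : mpoly.dhomog n.+1 R k.+1,
    ddh l w1 = w j /\ forall v, v \in b' -> dd v w1 = 0.
  have [w1 [hw1 lw1 bw1]] := antiderivative lb' (mpoly.dhomog_is_dhomog (w j))
    (fun v vb => wb v vb j).
  by exists (mpoly.DHomog hw1); split=> //; apply: val_inj.
have [g gP] := choice H.
exists [ffun j => g j].
  by apply/K1P => v vb j; rewrite ffunE; apply: (gP j).2.
by rewrite lE; apply/ffunP => j; rewrite !ffunE (gP j).1.
Qed.

Lemma killed_frame s k : exists r, forall b0, \dim b0 = s ->
  exists e : 'I_r -> W k,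
    (forall z : 'rV[R]_r, killed b0 (\sum_i z 0 i *: e i) -> z = 0) /\
    forall b, \dim b = s ->
      (forall z : 'rV[R]_r, killed b (\sum_i z 0 i *: e i) -> z = 0) ->
      forall w, exists z : 'rV[R]_r, killed b (w - \sum_i z 0 i *: e i).
Proof.
have [d D] := killed_dim s k; exists (\dim {:W k} - d)%N => b0 db0.
have [K0 K0P dK0] := D _ db0; have [e [e0 eK]] := complement_frame dK0.
exists e; split=> [z /K0P|b db ind w]; first exact: e0.
have [K KP dK] := D _ db.
have [|z /KP] := eK K dK _ w; first by move=> z /KP; apply: ind.
by exists z.
Qed.

End KernelRank.

(** * Partial derivatives of smooth maps *)

Section SmoothDerivatives.
Context {R : realType} {U : normedModType R}.

Lemma smooth_near (V : normedModType R) (f : U -> V) a :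
  smooth_at f a -> \forall x \near a, smooth_at f x.
Proof.
move=> /smooth_atP[ O [ oO Oa fC]]; near=> x; apply/smooth_atP; exists O.
by split=> //; near: x; apply: open_nbhs_nbhs.
Unshelve. all: by end_near. Qed.

Lemma smooth_derive (V : normedModType R) (f : U -> V) a v :
  smooth_at f a -> smooth_at ('D_v f) a.
Proof.
move=> /smooth_atP[ O [ oO Oa fC]]; apply/smooth_atP; exists O; split=> // k.
exact: (fC k.+1).2.
Qed.

Lemma smooth_derivable (V : normedModType R) (f : U -> V) a v :
  smooth_at f a -> derivable f a v.
Proof. by move=> /smooth_atP[ O [ oO Oa fC]]; have [_] := Ck0 (fC 0) Oa. Qed.

Context {p r : nat}.
Implicit Type f : U -> 'M[R]_(p, r).

Lemma smooth_derive_coord f a v i j : smooth_at f a ->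
  \forall x \near a, ('D_v f x) i j = 'D_v (fun x => f x i j : R^o) x.
Proof.
move=> /smooth_near; apply: filterS => x fx.
by rewrite derive_mx ?mxE //; apply: smooth_derivable.
Qed.

Lemma smooth_coord_near f a i j : smooth_at f a ->
  \forall x \near a, smooth_at (fun x => f x i j : R^o) x.
Proof. by move=> /smooth_near; apply: filterS => x /smooth_mx. Qed.

Lemma smooth_deriveD f a u v :
  smooth_at f a -> 'D_(u + v) f a = 'D_u f a + 'D_v f a.
Proof.
move=> fs; apply/matrixP => i j; rewrite mxE.
rewrite !(nbhs_singleton (smooth_derive_coord _ i j fs)).
have fsj := smooth_coord_near i j fs.
have fsja := nbhs_singleton fsj.
have d1 := smooth_derivable (v := u) fsja.
have c1 := smooth_continuous (smooth_derive v fsja).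
suff d2 : \forall y \near a, derivable (fun x => f x i j : R^o) y v.
  by have [_ ->] := derivable_DvD d1 d2 c1.
by apply: filterS fsj => x; apply: smooth_derivable.
Qed.

Lemma smooth_deriveZ f a (c : R) v :
  smooth_at f a -> 'D_(c *: v) f a = c *: 'D_v f a.
Proof.
move=> fs; apply/matrixP => i j; rewrite mxE.
rewrite !(nbhs_singleton (smooth_derive_coord _ i j fs)).
have fsja := nbhs_singleton (smooth_coord_near i j fs).
exact: DvZ (smooth_derivable (v := v) fsja).
Qed.

Lemma smooth_Schwarz f a u v :
  smooth_at f a -> 'D_u ('D_v f) a = 'D_v ('D_u f) a.
Proof.
move=> fs; apply/matrixP => i j.
have E1 := nbhs_singleton (smooth_derive_coord u i j (smooth_derive v fs)).
have E2 := nbhs_singleton (smooth_derive_coord v i j (smooth_derive u fs)).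
transitivity ('D_u ('D_v (fun x => f x i j : R^o)) a).
  apply: (etrans E1); apply: near_eq_derive; exact: smooth_derive_coord.
transitivity ('D_v ('D_u (fun x => f x i j : R^o)) a); last first.
  apply: esym; apply: (etrans E2); apply: near_eq_derive; exact: smooth_derive_coord.
have fsj := smooth_coord_near i j fs; have fsja := nbhs_singleton fsj.
apply: Schwarz.
- apply: filterS fsj => x fx.
  split; [exact: smooth_derivable fx|exact: smooth_derivable fx| |].
    exact: smooth_derivable (smooth_derive v fx).
  exact: smooth_derivable (smooth_derive u fx).
- exact: smooth_continuous (smooth_derive u (smooth_derive v fsja)).
- exact: smooth_continuous (smooth_derive v (smooth_derive u fsja)).
Qed.

End SmoothDerivatives.

(** * Iterated partial derivatives and polynomial maps *)

Section Partials.
Context {R : realType} {n m : nat}.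
Local Notation L := 'rV[R]_n.
Local Notation N := 'rV[R]_m.
Implicit Types (f g : L -> N) (x l : L).

Lemma smooth_partials u f x : smooth_at f x -> smooth_at (partials u f) x.
Proof. by move=> fs; elim: u => [|i u IH]; [exact: fs|exact: (smooth_derive _ IH)]. Qed.

Lemma near_partials u f g x :
  (\forall y \near x, f y = g y) -> \forall y \near x, partials u f y = partials u g y.
Proof.
move=> fg; elim: u => //= i u IH.
have := nbhs_interior IH; apply: filterS => y IHy.
exact: near_eq_derive.
Qed.

Lemma partials_cat u t f : partials (u ++ t) f = partials u (partials t f).
Proof. by rewrite /partials map_cat /iter_derive foldr_cat. Qed.

(** The equality holds near [x] and not merely at [x], so that it can be differentiated once
    more. *)
Lemma partials_swap u t i j f x : smooth_at f x ->
  \forall y \near x, partials (u ++ i :: j :: t) f y = partials (u ++ j :: i :: t) f y.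
Proof.
move=> fs; rewrite !partials_cat; apply: near_partials.
have := smooth_near (smooth_partials t fs); apply: filterS => y fy.
exact: smooth_Schwarz.
Qed.

Lemma derive_partials f x l : smooth_at f x ->
  'D_l f x = \sum_i l 0 i *: 'D_(delta_mx 0 i) f x.
Proof.
move=> fs; rewrite {1}(row_sum_delta l).
elim/big_rec2: _ => [|i y v _ IH]; first by rewrite derive0.
by rewrite smooth_deriveD // smooth_deriveZ // IH.
Qed.

Lemma partialsD u f g x : smooth_at f x -> smooth_at g x ->
  \forall y \near x, partials u (fun y => f y + g y) y = partials u f y + partials u g y.
Proof.
move=> fs gs; elim: u => [|i u IH]; first by apply: filterE => y.
have sfu := smooth_near (smooth_partials u fs).
have sgu := smooth_near (smooth_partials u gs).
apply: filterS3 sfu sgu (nbhs_interior IH) => y sf sg IHy.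
rewrite [LHS](near_eq_derive _ IHy); apply: deriveD.
  exact: smooth_derivable sf.
exact: smooth_derivable sg.
Qed.

Definition poly_map x (w : 'I_m -> mpoly.mpoly n R) (y : L) : N :=
  \row_j mpoly.meval ((y - x) 0) (w j).

Lemma derive_poly_map x w v : 'D_v (poly_map x w) = poly_map x (fun j => dd v (w j)).
Proof.
apply/funext => y; have dw j := meval_derive x (w j) y v.
have E i j : (fun y => poly_map x w y i j) = (fun y => mpoly.meval ((y - x) 0) (w j) : R^o).
  by apply/funext => y'; rewrite mxE.
rewrite derive_mx; last first.
  by apply/derivable_mxP => i j; rewrite E; have [_ []] := dw j.
by apply/matrixP => i j; rewrite !mxE E; have [_ []] := dw j.
Qed.

Lemma smooth_poly_map x w y : smooth_at (poly_map x w) y.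
Proof.
apply/smooth_mx => i j; apply/smooth_atP; exists setT; split=> //; first exact: openT.
move=> k; rewrite (_ : (fun y => _) = (fun y => mpoly.meval ((y - x) 0) (w j) : R^o)); last first.
  by apply/funext => y'; rewrite mxE.
elim: k (w j) => [|k IH] p.
  split=> // z _; split=> [|v]; first by have [cp _] := meval_derive x p z 0; apply: cp.
  by have [_ []] := meval_derive x p z v.
split=> [z _|v].
  split=> [|v]; first by have [cp _] := meval_derive x p z 0; apply: cp.
  by have [_ []] := meval_derive x p z v.
rewrite (_ : 'D_v _ = (fun y => mpoly.meval ((y - x) 0) (dd v p) : R^o)) //.
by apply/funext => z; have [_ []] := meval_derive x p z v.
Qed.

Lemma partials_poly_map u x w : partials u (poly_map x w) = poly_map x (fun j => ders u (w j)).
Proof.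
elim: u => [//|i u IH]; rewrite [LHS]/= -/(partials u _).
change ('D_(delta_mx 0 i) (partials u (poly_map x w)) = poly_map x (fun j => ders (i :: u) (w j))).
rewrite IH derive_poly_map; congr poly_map; apply/funext => j.
by rewrite dd_delta.
Qed.

Lemma poly_map_center x w : poly_map x w x = \row_j mpoly.meval (fun=> 0) (w j).
Proof.
apply/rowP => j; rewrite !mxE; apply: mpoly.meval_eq => i.
by rewrite subrr mxE.
Qed.

End Partials.

(** * The Cartan plane *)

Section JetSpace.
Context {R : realType} {n m q' : nat}.
Local Notation q := q'.+1.
Local Notation L := 'rV[R]_n.+1.
Local Notation N := 'rV[R]_m.
Local Notation arr := {ffun q.-bseq 'I_n.+1 -> N}.
Local Notation J := (jet_coords R n.+1 m q).
Local Notation W k := (homog_poly R n.+1 m k).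
Implicit Types (l : L) (z : J).

(* A polynomial of degree [q] as a tangent vector to the fibre of
   J^q -> J^(q - 1): its derivatives along the words of length [q], the other
   coordinates being zero. *)
Definition warr (p : W q) : arr :=
  [ffun u : q.-bseq 'I_n.+1 => if size u == q then
     \row_j mpoly.meval (fun=> 0) (ders u (p j)) else 0].

Lemma warr_is_linear : linear warr.
Proof.
move=> c p p'; apply/ffunP => u; rewrite !ffunE /=.
case: ifP => _; last by rewrite scaler0 addr0.
by apply/rowP => j; rewrite !mxE !ffunE /= linearP /= mpoly.mevalD mpoly.mevalZ.
Qed.
HB.instance Definition _ := GRing.isLinear.Build R (W q) arr _ warr warr_is_linear.

Definition vert (p : W q) : J := (0, warr p).

Lemma vert_is_linear : linear vert.
Proof.
by move=> c p p'; congr pair; rewrite ?linearP //= scaler0 addr0.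
Qed.
HB.instance Definition _ := GRing.isLinear.Build R (W q) J _ vert vert_is_linear.

Lemma warr0 : warr 0 = 0.
Proof. exact: linear0. Qed.

Lemma vertD p p' : vert (p + p') = vert p + vert p'.
Proof. exact: linearD. Qed.

Lemma vert0 : vert 0 = 0.
Proof. exact: linear0. Qed.

Lemma warr_inj : injective warr.
Proof.
move=> p p' /eqP; rewrite -subr_eq0 -linearB /= => /eqP pp'.
apply/eqP; rewrite -subr_eq0; apply/eqP; move: (p - p') pp' => {p p'} p p0.
apply/ffunP => j; rewrite ffunE; apply: val_inj => /=.
apply: (ders_eq0 (mpoly.dhomog_is_dhomog (p j))) => u su.
have := congr1 (fun h : arr => h (insub_bseq q u)) p0.
rewrite !ffunE /insub_bseq insubdK ?unfold_in ?su //= eqxx.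
by move=> /rowP/(_ j); rewrite !mxE.
Qed.

Lemma ddwDl k l l' (w : W k.+1) : ddw (l + l') w = ddw l w + ddw l' w.
Proof. by apply/ffunP => j; rewrite !ffunE; apply: val_inj; rewrite /= ddDl. Qed.

Lemma ddwZl k c l (w : W k.+1) : ddw (c *: l) w = c *: ddw l w.
Proof. by apply/ffunP => j; rewrite !ffunE; apply: val_inj; rewrite /= ddZl. Qed.

Lemma ddw_comm k l l' (w : W k.+2) : ddw l (ddw l' w) = ddw l' (ddw l w).
Proof. by apply/ffunP => j; rewrite !ffunE; apply: val_inj; rewrite /= dd_comm. Qed.

(* The action of [w] on integral elements: moves [z] by the contraction of [w]
   with the horizontal part of [z]. *)
Definition shear (w : W q.+1) z : J := (z.1, z.2 + warr (ddw z.1 w)).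

Lemma shear_is_linear w : linear (shear w).
Proof.
move=> c z z'; rewrite /shear /=; congr pair.
by rewrite ddwDl ddwZl linearP /= scalerDr addrACA.
Qed.
HB.instance Definition _ w := GRing.isLinear.Build R J J _ (shear w) (shear_is_linear w).

Lemma ddw0l k (w : W k.+1) : ddw 0 w = 0.
Proof. by rewrite -(scale0r (0 : L)) ddwZl scale0r. Qed.

Lemma ddw0 k l : ddw l 0 = 0 :> W k.
Proof. exact: (linear0 (@ddw R n.+1 m k l)). Qed.

Lemma ddwDr k l (w w' : W k.+1) : ddw l (w + w') = ddw l w + ddw l w'.
Proof. exact: (linearD (@ddw R n.+1 m k l)). Qed.

Lemma shear_zero w : shear w 0 = 0.
Proof. by rewrite /shear /= ddw0l linear0 addr0. Qed.

Lemma shearD w w' z : shear w (shear w' z) = shear (w' + w) z.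
Proof. by rewrite /shear /= -addrA -!linearD. Qed.

Lemma shear0 z : shear 0 z = z.
Proof. by rewrite /shear !linear0 addr0; case: z. Qed.

Variables (f : L -> N) (x0 : L).

(* The integral element L.  For smooth [f] this is [prolong_tangent q f x0]
   (lemma [tauE]), but it is linear in [l] without any assumption. *)
Definition tau l : J := \sum_i l 0 i *: prolong_tangent q f x0 (delta_mx 0 i).

Lemma tau_is_linear : linear tau.
Proof.
move=> c l l'; rewrite /tau scaler_sumr -big_split /=; apply: eq_bigr => i _.
by rewrite !mxE scalerDl scalerA.
Qed.
HB.instance Definition _ := GRing.isLinear.Build R L J _ tau tau_is_linear.

Lemma tau_zero : tau 0 = 0.
Proof. by rewrite /tau big1 // => i _; rewrite mxE scale0r. Qed.

Lemma tau1 l : (tau l).1 = l.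
Proof.
rewrite /tau (raddf_sum (@fst L arr)) [RHS]row_sum_delta.
by apply: eq_bigr.
Qed.

Lemma tauE l : smooth_at f x0 -> tau l = prolong_tangent q f x0 l.
Proof.
move=> fs; rewrite [LHS]surjective_pairing tau1; congr pair.
rewrite /tau (raddf_sum (@snd L arr)); apply/ffunP => u.
rewrite sum_ffunE ffunE derive_partials; last exact: smooth_partials.
by apply: eq_bigr => i _; rewrite !ffunE.
Qed.

End JetSpace.

(** * Prolongations with a given jet and the span of their tangent spaces *)

Section CartanPlane.
Context {R : realType} {n m q' : nat}.
Local Notation q := q'.+1.
Local Notation L := 'rV[R]_n.+1.
Local Notation N := 'rV[R]_m.
Local Notation J := (jet_coords R n.+1 m q).
Local Notation W k := (homog_poly R n.+1 m k).
Local Notation homog k := (@mpoly.ishomog1 n.+1 R k (mpoly.mpoly_mdeg__canonical__mpoly_Measure n.+1)).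
Implicit Types (l : L) (f g : L -> N).

Definition perturb f x0 (w : W q.+1) : L -> N :=
  fun x => f x + poly_map x0 (fun j => mpoly.mpoly_of_dhomog (w j)) x.

Lemma smooth_perturb f x0 w x : smooth_at f x -> smooth_at (perturb f x0 w) x.
Proof. by move=> fs; apply: smoothD fs (smooth_poly_map _ _ _). Qed.

Lemma ders_meval0 k (u : seq 'I_n.+1) (p : mpoly.mpoly n.+1 R) :
  p \is homog k -> (size u < k)%N -> mpoly.meval (fun=> 0) (ders u p) = 0.
Proof.
move=> hp uk; apply: (@homogS_meval0 _ _ (k - (size u).+1)).
by apply: ders_homog; rewrite addnS -addSn subnKC.
Qed.

Lemma perturb_same_jet f x0 w : smooth_at f x0 -> same_jet q (perturb f x0 w) f x0.
Proof.
move=> fs u su; have sp := smooth_poly_map x0 (fun j => mpoly.mpoly_of_dhomog (w j)) x0.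
rewrite (nbhs_singleton (partialsD u fs sp)) partials_poly_map poly_map_center.
rewrite -[RHS]addr0; congr (_ + _); apply/rowP => j; rewrite !mxE.
by apply: (ders_meval0 (mpoly.dhomog_is_dhomog (w j))).
Qed.

(** The added polynomial has degree one more than the order of the jet: its derivatives up to order
    [q] vanish at [x0], but those of order [q] have a nonzero differential in general, the one
    recorded by [warr (ddw l w)]. *)
Lemma prolong_perturb f x0 w l : smooth_at f x0 ->
  prolong_tangent q (perturb f x0 w) x0 l = shear w (tau f x0 l).
Proof.
move=> fs; rewrite /shear tau1 tauE // /prolong_tangent /=; congr pair.
apply/ffunP => u; rewrite !ffunE.
have sp := smooth_poly_map x0 (fun j => mpoly.mpoly_of_dhomog (w j)) x0.
rewrite (near_eq_derive _ (partialsD u fs sp)) deriveD; last 2 first.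
- exact: smooth_derivable (smooth_partials u fs).
- exact: smooth_derivable (smooth_partials u sp).
congr (_ + _).
transitivity (poly_map x0 (fun j => dd l (ders u (w j))) x0).
  by rewrite -derive_poly_map -partials_poly_map.
rewrite poly_map_center.
case: ifP => su; apply/rowP => j; rewrite !mxE.
  by rewrite !ffunE /= ders_dd.
rewrite -ders_dd (ders_meval0 (dd_homog l (mpoly.dhomog_is_dhomog (w j)))) //.
by rewrite ltn_neqAle su size_bseq.
Qed.

(** Coordinates along words shorter than [q] agree, because their derivative along [l] combines
    partial derivatives of order at most [q], fixed by the jet. The difference of top order is
    symmetric by Schwarz, hence the derivative array of a polynomial. *)
Lemma prolong_vertical f g x0 l : smooth_at f x0 -> smooth_at g x0 ->
  same_jet q g f x0 ->
  exists p : W q, (prolong_tangent q g x0 l).2 = (tau f x0 l).2 + warr p.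
Proof.
move=> fs gs fg; rewrite tauE //.
pose T j u := ('D_l (partials u g) x0 - 'D_l (partials u f) x0) 0 j.
have Tsym j : sym_words (T j).
  move=> u t i i'; rewrite /T (near_eq_derive _ (partials_swap u t i i' gs)).
  by rewrite (near_eq_derive _ (partials_swap u t i i' fs)).
have H j : exists p : mpoly.dhomog n.+1 R q, forall u, size u = q ->
    mpoly.meval (fun=> 0) (ders u p) = T j u.
  have [p hp pT] := words_poly q (Tsym j).
  by exists (mpoly.DHomog hp).
have [p pP] := choice H; exists [ffun j => p j]; apply/ffunP => u.
rewrite !ffunE; apply/eqP; rewrite addrC -subr_eq; apply/eqP.
case: ifP => [/eqP su|su]; first by apply/rowP => j; rewrite [RHS]mxE ffunE pP.
have su' : (size u < q)%N by rewrite ltn_neqAle su size_bseq.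
rewrite !derive_partials; try exact: smooth_partials.
rewrite -sumrB big1 // => i _; rewrite -scalerBr.
have E : 'D_(delta_mx 0 i) (partials u g) x0 = 'D_(delta_mx 0 i) (partials u f) x0.
  exact: fg (i :: u) su'.
by rewrite E subrr scaler0.
Qed.

Variables (E : Type) (A : set (param 'rV[R]_(n.+1 + m) E)).
Variables (S0 : set E).
Variables (c : param 'rV[R]_(n.+1 + m) E) (hc : admissible A c).
Variables (a : 'rV[R]_(n.+1 + m)) (ha : pdom c a) (hy : S0 (c a)).
Variables (f : L -> N) (hf : graph_near c a S0 f).
Local Notation x0 := (lsubmx a).

Lemma graph_center : rsubmx a = f x0.
Proof. by have := nbhs_singleton hf.2; move/iffLR; apply. Qed.

Lemma graph_submanifold g : smooth_at g x0 -> g x0 = f x0 -> exists S,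
  [/\ submanifold A S, S (c a) & graph_near c a S g].
Proof.
move=> gs gf; have [oc cinj _] := hc.
have lc : continuous (@lsubmx R 1 n.+1 m).
  by move=> y; apply: differentiable_continuous; exact: differentiable_lsubmx.
(* The graph is cut down to the points over which [g] is smooth, so that it is a submanifold at each
   of its points. Injectivity of [c] on its domain ensures that, read in the chart, it contains
   nothing but the graph. *)
pose Z := pdom c `&` interior [set z | smooth_at g (lsubmx z)].
have oZ : open Z by apply: openI => //; apply: open_interior.
have Za : Z a by split=> //; apply: (lc a); exact: smooth_near gs.
pose S := [set y | exists z, [/\ Z z, c z = y & rsubmx z = g (lsubmx z)]].
have graphS z : Z z -> graph_near c z S g.
  move=> Zz; split; first by have [_ /interior_subset] := Zz.
  have : \forall z' \near z, Z z' by apply: open_nbhs_nbhs.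
  apply: filterS => z' Zz'; split=> [[z2 [Zz2 czz2 E2]]|E2]; last by exists z'.
  suff -> : z' = z2 by [].
  by apply: cinj; rewrite ?inE; [exact: Zz'.1|exact: Zz2.1|].
have Sa : S (c a) by exists a; split=> //; rewrite graph_center gf.
exists S; split=> //; last exact: graphS.
move=> y [z [Zz <- E2]]; exists c, z, g; split=> //; first exact: Zz.1.
exact: graphS.
Qed.

Lemma cartan_planeP (z : J) : cartan_plane q A c a f z <->
  exists p : W q, z.2 = (tau f x0 z.1).2 + warr p.
Proof.
have fs : smooth_at f x0 := hf.1.
have perturb_in (F : {vspace J}) w l :
    (forall S g v, submanifold A S -> S (c a) -> graph_near c a S g ->
        same_jet q g f x0 -> prolong_tangent q g x0 v \in F) ->
    shear w (tau f x0 l) \in F.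
  move=> FP; rewrite -prolong_perturb //.
  have gs := smooth_perturb x0 w fs.
  have [|S [SA Sa Sg]] := graph_submanifold gs.
    exact: (perturb_same_jet w fs (w := [::])).
  exact: FP SA Sa Sg (perturb_same_jet w fs).
split=> [Cz|[p zE] F FP].
  have : z \in (limg (linfun (tau f x0)) + limg (linfun (@vert R n m q')))%VS.
    apply: Cz => S g v SA Sa [gs Sg] gf.
    have [p pE] := prolong_vertical v fs gs gf.
    have -> : prolong_tangent q g x0 v = tau f x0 v + vert p.
      rewrite [LHS]surjective_pairing pE; apply: injective_projections => /=.
        by rewrite tau1 addr0.
      by [].
    apply: memv_add; apply/memv_imgP; first by exists v; rewrite ?memvf ?lfunE.
    by exists p; rewrite ?memvf ?lfunE.
  move=> /memv_addP[_ /memv_imgP[l _ ->] [_ /memv_imgP[p _ ->] ->]]; exists p.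
  by rewrite !lfunE /= tau1 addr0.
(* Every [p] is the derivative of some polynomial along one fixed nonzero direction, by
   [antiderivative] over the zero subspace. Hence [vert p] is the difference of two tangent vectors
   of prolongations over that direction. *)
have l0 : (delta_mx 0 0 : L) \notin (0 : {vspace L})%VS.
  by rewrite memv0; apply/eqP => /rowP/(_ 0)/eqP; rewrite !mxE !eqxx oner_eq0.
have H j : exists w : mpoly.dhomog n.+1 R q.+1, ddh (delta_mx 0 0) w = p j.
  have [||w [hw lw _]] := antiderivative (p := p j) (k := q) l0.
  - exact: mpoly.dhomog_is_dhomog.
  - by move=> v; rewrite memv0 => /eqP ->; rewrite dd0l.
  by exists (mpoly.DHomog hw); apply: val_inj.
have [w wP] := choice H; pose w' : W q.+1 := [ffun j => w j].
have w'E : ddw (delta_mx 0 0) w' = p by apply/ffunP => j; rewrite !ffunE wP.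
suff -> : z = tau f x0 z.1 + (shear w' (tau f x0 (delta_mx 0 0)) - tau f x0 (delta_mx 0 0)).
  apply: rpredD; first by rewrite -(shear0 (tau _ _ _)); apply: perturb_in.
  apply: rpredB; first exact: perturb_in.
  by rewrite -(shear0 (tau _ _ _)); apply: perturb_in.
rewrite /shear tau1 w'E; case: z zE => z1 z2 /= ->.
rewrite [tau f x0 z1]surjective_pairing [X in _ + (_ - X)]surjective_pairing !tau1.
congr pair; rewrite /= ?subrr ?addr0 //.
by rewrite addrAC subrr add0r.
Qed.

End CartanPlane.

(** * Horizontal integral elements *)

Section Elements.
Context {R : realType} {n m q' : nat}.
Local Notation q := q'.+1.
Local Notation L := 'rV[R]_n.+1.
Local Notation N := 'rV[R]_m.
Local Notation arr := {ffun q.-bseq 'I_n.+1 -> N}.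
Local Notation J := (jet_coords R n.+1 m q).
Local Notation W k := (homog_poly R n.+1 m k).
Implicit Types (l : L) (z : J) (F : {vspace J}).

Lemma contract_warr l (p : W q) (t : q'.-tuple 'I_n.+1) :
  Defs.contract l (warr p) t = \row_j mpoly.meval (fun=> 0) (ders t (ddw l p j)).
Proof.
rewrite ffunE; apply/rowP => j; rewrite summxE !mxE !ffunE /= ders_dd /dd linear_sum.
apply: eq_bigr => i _; rewrite !mxE ffunE /insub_bseq insubdK ?unfold_in /= ?size_tuple //.
by rewrite eqxx mxE mpoly.mevalZ.
Qed.

Lemma contract_warr_eq l l' (p p' : W q) :
  Defs.contract l (warr p) = Defs.contract l' (warr p') <-> ddw l p = ddw l' p'.
Proof.
split=> [E|E]; last by apply/ffunP => t; rewrite !contract_warr E.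
apply/ffunP => j; apply/eqP; rewrite -subr_eq0; apply/eqP/val_inj.
apply: (ders_eq0 (mpoly.dhomog_is_dhomog (ddw l p j - ddw l' p' j))) => u su.
have /eqP st := su.
have /ffunP/(_ (Tuple st)) := E; rewrite !contract_warr => /rowP/(_ j).
rewrite !mxE /= => Ej.
by rewrite linearB mpoly.mevalB /= Ej subrr.
Qed.

Variables (f : L -> N) (x0 : L).
Local Notation tau := (tau f x0).

(** [integral_elements] read in the splitting of the Cartan plane by [tau] and [vert]. The vertical
    component is quantified rather than computed; it is unique since [warr] is injective. *)
Definition elem s F := [/\ \dim F = s,
  forall z, z \in F -> exists p : W q, z = tau z.1 + vert p,
  forall z z' (p p' : W q), z \in F -> z' \in F ->
    z = tau z.1 + vert p -> z' = tau z'.1 + vert p' -> ddw z.1 p' = ddw z'.1 p &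
  forall z, z \in F -> z.1 = 0 -> z = 0].

Lemma tau_vertE z (p : W q) : z = tau z.1 + vert p <-> z.2 = (tau z.1).2 + warr p.
Proof.
split=> [E|E]; first by rewrite {1}E.
by apply: injective_projections => //=; rewrite tau1 addr0.
Qed.

Definition shearV (w : W q.+1) F : {vspace J} := (linfun (shear w) @: F)%VS.

Lemma underlineP F l : reflect (exists2 z, z \in F & z.1 = l) (l \in underline q F).
Proof.
apply: (iffP memv_imgP) => [[z zF ->]|[z zF <-]]; exists z => //; by rewrite lfunE.
Qed.

Lemma shearVP w F z : reflect (exists2 z', z' \in F & z = shear w z') (z \in shearV w F).
Proof.
by apply: (iffP memv_imgP) => [[z' zF ->]|[z' zF ->]]; exists z' => //; rewrite lfunE.
Qed.

Lemma shear1 w z : (shear w z).1 = z.1. Proof. by []. Qed.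

Lemma shear_in w F z : z \in F -> shear w z \in shearV w F.
Proof. by move=> zF; apply/shearVP; exists z. Qed.

Lemma shearVD w w' F : shearV w' (shearV w F) = shearV (w + w') F.
Proof.
apply/vspaceP => z; apply/shearVP/shearVP => [[_ /shearVP[z' zF ->] ->]|[z' zF ->]].
  by exists z' => //; rewrite shearD.
by exists (shear w z'); [exact: shear_in|rewrite shearD].
Qed.

Lemma dim_shearV w F : \dim (shearV w F) = \dim F.
Proof.
apply: limg_dim_eq; apply/eqP; rewrite -subv0; apply/subvP => z.
rewrite memv_cap memv_ker lfunE memv0 => /andP[_ /eqP zw].
have E : shear (- w) (shear w z) = z by rewrite shearD subrr shear0.
have zw' : shear (- w) (shear w z) = shear (- w) 0 := congr1 (shear (- w)) zw.
by apply/eqP; exact: etrans (esym E) (etrans zw' (shear_zero (- w))).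
Qed.

Lemma underline_shearV w F : underline q (shearV w F) = underline q F.
Proof.
apply/vspaceP => l; apply/underlineP/underlineP => [[_ /shearVP[z zF ->] <-]|[z zF <-]].
  by exists z.
by exists (shear w z); first exact: shear_in.
Qed.

Lemma shear_tau_vert w z (p : W q) : z = tau z.1 + vert p ->
  shear w z = tau z.1 + vert (p + ddw z.1 w).
Proof.
move=> zE; rewrite vertD addrA -zE.
by apply: injective_projections; rewrite //= addr0.
Qed.

Lemma tau_vert_inj l (p p' : W q) : tau l + vert p = tau l + vert p' -> p = p'.
Proof. by move=> /addrI[/warr_inj]. Qed.

Lemma tau_vert0 l (p : W q) : tau l = tau l + vert p -> p = 0.
Proof. by move=> E; apply: (@tau_vert_inj l); rewrite -E vert0 addr0. Qed.

(** Integrality survives because second derivatives of [w] commute: the terms added on the two sides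
    of the condition are equal. *)
Lemma elem_shearV s w F : elem s F -> elem s (shearV w F).
Proof.
move=> [dF CF OF HF]; split.
- by rewrite dim_shearV.
- move=> _ /shearVP[z zF ->]; have [p zE] := CF _ zF.
  by exists (p + ddw z.1 w); exact: shear_tau_vert zE.
- move=> _ _ p p' /shearVP[z zF ->] /shearVP[z' zF' ->]; rewrite !shear1.
  have [r zE] := CF _ zF; have [r' zE'] := CF _ zF'.
  rewrite (shear_tau_vert w zE) (shear_tau_vert w zE').
  move=> /tau_vert_inj <- /tau_vert_inj <-.
  rewrite !ddwDr (OF z z' r r') //.
  by congr (_ + _); exact: ddw_comm.
by move=> _ /shearVP[z zF ->]; rewrite shear1 => /HF -> //; rewrite shear_zero.
Qed.

Lemma elem_uniq s F z z' : elem s F -> z \in F -> z' \in F -> z.1 = z'.1 -> z = z'.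
Proof.
move=> [_ _ _ HF] zF zF' E; apply/eqP; rewrite -subr_eq0; apply/eqP/HF.
  exact: rpredB.
by rewrite /= E subrr.
Qed.

Lemma dim_underline s F : elem s F -> \dim (underline q F) = s.
Proof.
move=> [dF _ _ HF]; rewrite -dF; apply: limg_dim_eq; apply/eqP; rewrite -subv0.
by apply/subvP => z; rewrite memv_cap memv_ker lfunE memv0 => /andP[/HF H /eqP/H ->].
Qed.

(** A shear preserves horizontal parts and an integral element has one vector over each point of its
    base, so it can only be fixed pointwise. *)
Lemma shearV_fix s w F : elem s F -> shearV w F = F <-> killed (underline q F) w.
Proof.
move=> EF; split=> [wF _ /underlineP[z zF <-] j|wk].
  have E : shear w z = z.
    by apply: (elem_uniq EF) => //; rewrite -wF; apply: shear_in.
  have /warr_inj : warr (ddw z.1 w) = warr 0.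
    have E2 : z.2 + warr (ddw z.1 w) = z.2 := congr1 snd E.
    by rewrite warr0; apply: (@addrI _ z.2); rewrite E2 addr0.
  by move=> /ffunP/(_ j); rewrite !ffunE => /(congr1 val).
have E z : z \in F -> shear w z = z.
  move=> zF; have [p zE] : exists p : W q, z = tau z.1 + vert p by have [_ + _ _] := EF; apply.
  rewrite (shear_tau_vert w zE) (_ : ddw z.1 w = 0) ?addr0 //.
  apply/ffunP => j; rewrite !ffunE; apply: val_inj; apply: wk.
  by apply/underlineP; exists z.
apply/vspaceP => z; apply/shearVP/idP => [[z' zF ->]|zF]; first by rewrite E.
by exists z; rewrite ?E.
Qed.

Lemma elem_tau s (b : {vspace L}) : \dim b = s -> elem s (linfun tau @: b)%VS.
Proof.
move=> db; split.
- rewrite -db; apply: limg_dim_eq; apply/eqP; rewrite -subv0; apply/subvP => l.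
  rewrite memv_cap memv_ker lfunE memv0 => /andP[_ /eqP/(congr1 fst)].
  by rewrite /= tau1 => ->.
- move=> _ /memv_imgP[l _ ->]; exists 0; by rewrite lfunE /= tau1 vert0 addr0.
- move=> _ _ p p' /memv_imgP[l _ ->] /memv_imgP[l' _ ->]; rewrite !lfunE /= !tau1.
  by move=> /tau_vert0 -> /tau_vert0 ->; rewrite !ddw0.
move=> _ /memv_imgP[l _ ->]; rewrite lfunE => l0.
have -> : l = 0 by rewrite -(tau1 (q' := q') f x0 l).
exact: tau_zero.
Qed.

Lemma underline_tau (b : {vspace L}) : underline q (linfun tau @: b)%VS = b.
Proof.
apply/vspaceP => l; apply/underlineP/idP => [[_ /memv_imgP[l' lb ->] <-]|lb].
  by rewrite lfunE /= tau1.
by exists (tau l); rewrite ?tau1 //; apply/memv_imgP; exists l; rewrite ?lfunE.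
Qed.

Lemma elem_transitive s F F' : elem s F -> elem s F' -> underline q F = underline q F' ->
  exists w, F' = shearV w F.
Proof.
move=> EF EF' FF'.
have [dF CF OF HF] := EF.
have [dF' CF' OF' HF'] := EF'.
pose X := vbasis (underline q F).
(* Past the end of the basis the default value is 0, which also lies in the base; lifts can thus be
   chosen for all natural numbers. *)
have XU (i : nat) : X`_i \in underline q F.
  have [iX|iX] := ltnP i (size X); first by apply/vbasis_mem/mem_nth.
  by rewrite nth_default // mem0v.
have lift (i : nat) : exists zr : (J * J) * (W q * W q),
    [/\ zr.1.1 \in F, zr.1.2 \in F', zr.1.1.1 = X`_i /\ zr.1.2.1 = X`_i,
     zr.1.1 = tau X`_i + vert zr.2.1 & zr.1.2 = tau X`_i + vert zr.2.2].
  have /underlineP[z zF zX] := XU i.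
  have /underlineP[z' zF' zX'] : X`_i \in underline q F' by rewrite -FF'.
  have [r zE] := CF _ zF; have [r' zE'] := CF' _ zF'.
  by exists ((z, z'), (r, r')); split=> //=; [rewrite zE zX|rewrite zE' zX'].
have [z zP] := choice lift.
pose p i := (z i).2.2 - (z i).2.1.
have pE i : (z i).2.2 = (z i).2.1 + p i by rewrite addrC subrK.
(* The difference of the integrality conditions of [F'] and [F] is the compatibility condition of
   [poincare]. *)
have comp i k : ddw X`_i (p k) = ddw X`_k (p i).
  have [zF zF' [z1 z1'] zE zE'] := zP i; have [yF yF' [y1 y1'] yE yE'] := zP k.
  have E1 : ddw X`_i (z k).2.1 = ddw X`_k (z i).2.1.
    by rewrite -{1}z1 -{1}y1; apply: (OF _ _ _ _ zF yF); rewrite ?z1 ?y1.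
  have E2 : ddw X`_i (z k).2.2 = ddw X`_k (z i).2.2.
    by rewrite -{1}z1' -{1}y1'; apply: (OF' _ _ _ _ zF' yF'); rewrite ?z1' ?y1'.
  by apply: (@addrI _ (ddw X`_i (z k).2.1)); rewrite -ddwDr -pE E2 pE ddwDr E1.
pose bs j := [seq (X`_i, mpoly.mpoly_of_dhomog (p i j)) | i <- iota 0 (size X)].
have H j : exists w : mpoly.dhomog n.+1 R q.+1, forall i, (i < size X)%N ->
    dd X`_i w = p i j.
  have [|||w hw wP] := @poincare R n.+1 q (bs j).
  - rewrite -map_comp -/(mkseq _ _) (_ : mkseq _ _ = X); first exact: basis_free (vbasisP _).
    by rewrite -[RHS](mkseq_nth 0).
  - by move=> _ /mapP[i _ ->]; exact: mpoly.dhomog_is_dhomog.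
  - move=> _ _ /mapP[i _ ->] /mapP[k _ ->] /=.
    by have /ffunP/(_ j) := comp i k; rewrite [LHS]ffunE [RHS]ffunE => /(congr1 val).
  exists (mpoly.DHomog hw) => i iX; apply: (wP (X`_i, _)).
  by apply/mapP; exists i; rewrite // mem_iota.
have [w wP] := choice H; pose w' : W q.+1 := [ffun j => w j].
have wE i : (i < size X)%N -> ddw X`_i w' = p i.
  move=> iX; apply/ffunP => j; apply: val_inj.
  rewrite [ddw _ _ _]ffunE /= [w' j]ffunE; exact: wP.
exists w'; have EG := elem_shearV w' EF; have [dG _ _ _] := EG.
(* Both elements contain the lifts [(z i).1.2] of a basis of the base, hence so
   does their intersection, which therefore has full dimension. *)
pose G := (F' :&: shearV w' F)%VS.
have XG : (underline q F <= underline q G)%VS.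
  rewrite -(span_basis (vbasisP (underline q F))); apply/span_subvP => _ /(nthP 0)[i iX <-].
  have [zF zF' [z1 z1'] zE zE'] := zP i.
  apply/underlineP; exists (z i).1.2; last exact: z1'.
  rewrite memv_cap zF' /=; apply/shearVP; exists (z i).1.1 => //.
  have zE2 : (z i).1.1 = tau (z i).1.1.1 + vert (z i).2.1 by rewrite z1.
  by rewrite zE' (shear_tau_vert w' zE2) z1 wE // -pE.
have sG : (s <= \dim G)%N.
  rewrite -(dim_underline EF) (leq_trans (dimvS XG)) //.
  by rewrite -(limg_ker_dim (linfun (@fst L arr)) G) leq_addl.
have GF' : G = F' by apply/eqP; rewrite eqEdim capvSl dF'.
have GF : G = shearV w' F by apply/eqP; rewrite eqEdim capvSr dG.
by rewrite -GF.
Qed.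

End Elements.

(** * Local triviality *)

Section Charts.
Context {R : realType}.

Lemma is_derive_linear (U V : normedModType R) (f : {linear U -> V}) x v :
  is_derive x v f (f v).
Proof.
have E : \forall h \near (0:R)^', h^-1 *: ((f \o shift x) (h *: v) - f x) = f v.
  near=> h; have h0 : h != 0 by near: h; exact: nbhs_dnbhs_neq.
  by rewrite /= [f (_ + _)]linearD addrK [f (_ *: _)]linearZZ scalerA mulVf // scale1r.
by split; [exact: is_cvg_near_cst E|exact: lim_near_cst E].
Unshelve. all: by end_near. Qed.

Lemma smooth_linear (U V : normedModType R) (f : {linear U -> V}) a :
  continuous f -> smooth_at f a.
Proof.
move=> fc; apply/smooth_atP; exists setT; split=> //; first exact: openT.
by move=> k; apply: (@Ck_lin R U V setT k f f fc) => x v; apply: is_derive_linear.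
Qed.

Lemma smooth_fst (U V : normedModType R) (a : U * V) : smooth_at fst a.
Proof. by apply: (smooth_linear (f := @fst U V)) => x; exact: cvg_fst. Qed.

Lemma smooth_snd (U V : normedModType R) (a : U * V) : smooth_at snd a.
Proof. by apply: (smooth_linear (f := @snd U V)) => x; exact: cvg_snd. Qed.

Context {V : vectType R} {s t : nat}.

Definition graph_row (e : s.-tuple V) (f : t.-tuple V) (M : 'M[R]_(s, t)) i : V :=
  tnth e i + \sum_j M i j *: tnth f j.

Lemma graph_spanE e f M : graph_span e f M = <<[seq graph_row e f M i | i <- enum 'I_s]>>%VS.
Proof. by []. Qed.

Lemma smooth_graph_row (U : normedModType R) (M : U -> 'M[R]_(s, t)) a e f i
    (l : {linear V -> R^o}) : (forall i j, smooth_at (fun x => M x i j : R^o) a) ->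
  smooth_at (fun x => l (graph_row e f (M x) i)) a.
Proof.
move=> Ms; have E x : l (tnth e i) + \sum_j M x i j * l (tnth f j) = l (graph_row e f (M x) i).
  rewrite /graph_row linearD linear_sum; congr (_ + _); apply: eq_bigr => j _.
  by rewrite linearZ.
under eq_fun do rewrite -E.
apply: smoothD; first exact: smooth_cst.
by apply: smooth_sum => j _; apply: smoothM; [exact: Ms|exact: smooth_cst].
Qed.

(** The components of the rows along [e] form the identity matrix. *)
Lemma free_graph_row (e : s.-tuple V) (f : t.-tuple V) M : basis_of fullv (e ++ f) ->
  free [seq graph_row e f M i | i <- enum 'I_s].
Proof.
move=> bX; pose X := [tuple of e ++ f]; have frX : free X := basis_free bX.
pose Y := [tuple graph_row e f M i | i < s].
suff : free Y by rewrite /Y /=.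
apply/freeP => k k0 i.
have YE (j : 'I_s) : Y`_j = graph_row e f M j by rewrite -tnth_nth tnth_mktuple.
have Ee (j : 'I_s) : tnth e j = X`_(lshift t j) by rewrite -(tnth_lshift e f) (tnth_nth 0).
have Ef (j : 'I_t) : tnth f j = X`_(rshift s j) by rewrite -(tnth_rshift e f) (tnth_nth 0).
have C j : coord X (lshift t i) (graph_row e f M j) = (j == i)%:R.
  rewrite /graph_row linearD linear_sum big1 => [|j' _]; last first.
    by rewrite linearZ /= Ef coord_free // eq_rlshift mulr0.
  rewrite addr0 Ee; apply: (etrans (coord_free _ _ frX)).
  by rewrite (inj_eq (@lshift_inj _ _)).
have := congr1 (coord X (lshift t i)) k0.
rewrite linear0 linear_sum (bigD1 i) //= big1 => [|j ji].
  by rewrite addr0 linearZ /= YE C eqxx mulr1.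
by rewrite linearZ /= YE C (negPf ji) mulr0.
Qed.

Lemma dim_graph_span (e : s.-tuple V) (f : t.-tuple V) M :
  basis_of fullv (e ++ f) -> \dim (graph_span e f M) = s.
Proof.
move=> bX; have /eqP := free_graph_row M bX.
by rewrite -graph_spanE size_map size_enum_ord.
Qed.

Lemma free_of_dim (u : 'I_s -> V) : \dim <<[seq u i | i <- enum 'I_s]>> = s ->
  free [seq u i | i <- enum 'I_s].
Proof. by move=> ds; apply/eqP; rewrite ds size_map size_enum_ord. Qed.

Lemma limg_span_seq (V' : vectType R) (h : 'Hom(V, V')) (u : 'I_s -> V) :
  (h @: <<[seq u i | i <- enum 'I_s]>>)%VS = <<[seq h (u i) | i <- enum 'I_s]>>%VS.
Proof. by rewrite limg_span -map_comp. Qed.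

End Charts.

(** * Smooth dependence of the coordinates in a frame *)

Section FrameSolve.
Context {R : realType} {n m k : nat}.
Local Notation L := 'rV[R]_n.+1.
Local Notation W k := (homog_poly R n.+1 m k).

Definition ddwl k (w : W k.+1) (l : L) : W k := ddw l w.

Lemma ddwl_is_linear j (w : W j.+1) : linear (ddwl w).
Proof. by move=> c l l'; rewrite /ddwl ddwDl ddwZl. Qed.
HB.instance Definition _ j (w : W j.+1) := GRing.isLinear.Build R L (W j) _ (ddwl w)
  (ddwl_is_linear w).

Lemma killed_span s (g : 'I_s -> L) (w : W k.+1) :
  killed <<[seq g i | i <- enum 'I_s]>>%VS w <-> forall i, ddw (g i) w = 0.
Proof.
split=> [kw i|kw l].
  apply/ffunP => j; apply: val_inj; rewrite [ddw _ _ _]ffunE [(0 : W k) j]ffunE /=; apply: kw.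
  by apply: memv_span; apply/mapP; exists i; rewrite ?mem_enum.
move=> ls j; have : l \in lker (linfun (ddwl w)).
  apply: subvP ls; apply/span_subvP => _ /mapP[i _ ->].
  by rewrite memv_ker lfunE; apply/eqP/kw.
rewrite memv_ker lfunE => /eqP/ffunP/(_ j); rewrite [LHS]ffunE [RHS]ffunE.
by move=> /(congr1 val).
Qed.

(** Each spanning vector [g i x] gives one polynomial equation, expanded in a basis of [W k].
    Independence of [e] modulo the polynomials killed by the span at [a] is exactly injectivity of
    this system. The right-hand side is zero for openness, a derivative of a fixed polynomial for
    coordinates of sections, a vertical part for the fibre coordinate. *)
Lemma frame_solve (U : normedModType R) s r (e : 'I_r -> W k.+1)
    (g : 'I_s -> U -> L) (y : 'I_s -> U -> W k) a :
  (forall i, smooth_vect (g i) a) -> (forall i, smooth_vect (y i) a) ->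
  (forall z : 'rV[R]_r,
     killed <<[seq g i a | i <- enum 'I_s]>>%VS (\sum_j z 0 j *: e j) -> z = 0) ->
  exists h : U -> 'rV[R]_r, smooth_at h a /\ \forall x \near a, forall z : 'rV[R]_r,
    (forall i, ddw (g i x) (\sum_j z 0 j *: e j) = y i x) -> z = h x.
Proof.
move=> gs ys ind.
pose vb := vbasis {:W k}.
pose AA j (it : 'I_s * 'I_(\dim {:W k})) x : R^o := coord vb it.2 (ddwl (e j) (g it.1 x)).
pose YY (it : 'I_s * 'I_(\dim {:W k})) x : R^o := coord vb it.2 (y it.1 x).
have AAs j it : smooth_at (AA j it) a := gs it.1 (coord vb it.2 \o ddwl (e j)).
have YYs it : smooth_at (YY it) a := ys it.1 (coord vb it.2).
have AAE (z : 'rV[R]_r) i kk x : \sum_j z 0 j * AA j (i, kk) x =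
    coord vb kk (ddw (g i x) (\sum_j z 0 j *: e j)).
  rewrite (linear_sum (@ddw R n.+1 m k (g i x))) linear_sum; apply: eq_bigr => j _.
  by rewrite linearZ linearZ.
have [z zA|h [hs hE]] := @smooth_solve R U r _ AA YY a AAs YYs.
  apply: ind; apply/killed_span => i.
  rewrite (coord_vbasis (memvf (ddw _ _))) big1 // => kk _.
  by rewrite -AAE zA scale0r.
exists h; split=> //; apply: filterS hE => x hx z zE; apply: hx => -[i kk].
by rewrite AAE zE.
Qed.

End FrameSolve.

(** * Integral elements in the splitting, and their projection to the base *)

Section Bundle.
Context {R : realType} {n m q' : nat}.
Local Notation q := q'.+1.
Local Notation L := 'rV[R]_n.+1.
Local Notation N := 'rV[R]_m.
Local Notation arr := {ffun q.-bseq 'I_n.+1 -> N}.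
Local Notation J := (jet_coords R n.+1 m q).
Local Notation W k := (homog_poly R n.+1 m k).

(** Inside the Cartan plane, tangency to the fibre amounts to a zero horizontal part, because [warr]
    has no coordinates along words shorter than [q]. *)
Lemma integral_elementsP s (E : Type) (A : set (param 'rV[R]_(n.+1 + m) E)) S0
    (c : param 'rV[R]_(n.+1 + m) E) a (f : L -> N) (F : {vspace J}) :
  admissible A c -> pdom c a -> S0 (c a) -> graph_near c a S0 f ->
  integral_elements q s A c a f F <-> elem f (lsubmx a) s F.
Proof.
move=> hc ha hy hf; set x0 := lsubmx a; have fs : smooth_at f x0 := hf.1.
have CP (z : J) : cartan_plane q A c a f z <-> exists p : W q, z = tau f x0 z.1 + vert p.
  rewrite (cartan_planeP hc ha hy hf); split=> -[p zE]; exists p.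
    exact/tau_vertE.
  exact/tau_vertE.
have VE (z : J) (p : W q) : z = tau f x0 z.1 + vert p -> vertical_part f x0 z = warr p.
  by move=> /tau_vertE zE; rewrite /vertical_part zE -tauE // addrC addKr.
have curvE (z z' : J) (p p' : W q) : z = tau f x0 z.1 + vert p -> z' = tau f x0 z'.1 + vert p' ->
    curvature f x0 z z' = 0 <-> ddw z.1 p' = ddw z'.1 p.
  move=> zE zE'; rewrite /curvature (VE _ _ zE) (VE _ _ zE').
  have CI := @contract_warr_eq R n m q' z.1 z'.1 p' p.
  by split=> [/eqP|/CI->]; [rewrite subr_eq0 => /eqP/CI|exact: subrr].
have FT (z : J) : z.1 = 0 -> (exists p : W q, z = tau f x0 z.1 + vert p) -> fibre_tangent z.
  move=> z1 [p /tau_vertE]; rewrite z1 tau_zero add0r => z2; split=> // w wq.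
  by rewrite z2 ffunE ltn_eqF.
split=> [[dF CF OF HF]|[dF CF OF HF]]; split=> //.
- by move=> z /CF/CP.
- by move=> z z' p p' zF zF' zE zE'; apply/(curvE _ _ _ _ zE zE'); apply: OF.
- by move=> z zF z1; apply: HF => //; apply: FT => //; apply/CP/CF.
- by move=> z /CF/CP.
- move=> z z' zF zF'; have [p zE] := CF _ zF; have [p' zE'] := CF _ zF'.
  by apply/(curvE _ _ _ _ zE zE'); apply: OF.
- by move=> z zF [z1 _]; apply: HF.
Qed.

(** The generalized inverse of [warr] makes this linear on all tangent vectors, while it is the
    vertical component only on the Cartan plane. Charts of the Grassmannian also contain subspaces
    that leave that plane. *)
Definition vpart (f : L -> N) x0 (z : J) : W q :=
  ((linfun (@warr R n m q'))^-1)%VF (z.2 - (tau f x0 z.1).2).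

Lemma vpart_is_linear f x0 : linear (vpart f x0).
Proof.
move=> c z z'; have H : (tau f x0 (c *: z + z').1 : J) = c *: tau f x0 z.1 + tau f x0 z'.1.
  exact: (@tau_is_linear R n m q' f x0 c z.1 z'.1).
rewrite /vpart H.
have -> : (c *: z + z').2 - (c *: tau f x0 z.1 + tau f x0 z'.1).2 =
    c *: (z.2 - (tau f x0 z.1).2) + (z'.2 - (tau f x0 z'.1).2).
  change (c *: z.2 + z'.2 - (c *: (tau f x0 z.1).2 + (tau f x0 z'.1).2) =
    c *: (z.2 - (tau f x0 z.1).2) + (z'.2 - (tau f x0 z'.1).2)).
  by rewrite scalerBr opprD addrACA.
exact: linearP.
Qed.
HB.instance Definition _ f x0 := GRing.isLinear.Build R J (W q) _ (vpart f x0)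
  (vpart_is_linear f x0).

Lemma vpartE f x0 l (p : W q) : vpart f x0 (tau f x0 l + vert p) = p.
Proof.
rewrite /vpart /= tau1 addr0 addrC addKr.
have -> : warr p = linfun (@warr R n m q') p by rewrite lfunE.
apply: lker0_lfunK; rewrite -subv0; apply/subvP => w.
by rewrite memv_ker lfunE memv0 -warr0 => /eqP/warr_inj ->.
Qed.

Lemma smooth_within_underline f x0 s F : elem f x0 s F ->
  smooth_within (grass_atlas J s) (grass_atlas L s) [set F | elem f x0 s F]
    (underline q) F.
Proof.
move=> EF c M [e [f' [bX ->]]] /= _ FE.
pose u i (M' : 'M[R]_(s, \dim {:J} - s)) : L := (graph_row e f' M' i).1.
have uE M' : underline q (graph_span e f' M') = <<[seq u i M' | i <- enum 'I_s]>>%VS.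
  rewrite /underline limg_span_seq; congr (<<_>>)%VS; apply: eq_map => i.
  by rewrite lfunE.
have us i : smooth_vect (u i) M.
  move=> l; pose lf : {linear J -> R^o} := (l \o @fst L arr).
  by apply: (smooth_graph_row e f' i lf) => i' j'; exact: smooth_coord.
have fr : free [seq u i M | i <- enum 'I_s].
  by apply: free_of_dim; rewrite -uE FE (dim_underline EF).
have [d [g [dA gs gE]]] := smooth_grass us fr.
exists d, g; split=> //; apply: filterS gE => M' [dg gE] _; split=> //.
by rewrite gE uE.
Qed.

End Bundle.

Lemma linear_functional_comb (R : realType) (V1 V2 : lmodType R)
    (h : {linear V1 -> V2}) (l : {linear V2 -> R^o}) r (z : 'rV[R]_r) (e : 'I_r -> V1) :
  l (h (\sum_j z 0 j *: e j)) = \sum_j z 0 j * l (h (e j)).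
Proof. by rewrite !linear_sum; apply: eq_bigr => j _; rewrite !linearZ. Qed.

(** * Smoothness of the local trivialization and of its inverse *)

Section Trivialization.
Context {R : realType} {n m q' : nat}.
Local Notation q := q'.+1.
Local Notation L := 'rV[R]_n.+1.
Local Notation N := 'rV[R]_m.
Local Notation arr := {ffun q.-bseq 'I_n.+1 -> N}.
Local Notation J := (jet_coords R n.+1 m q).
Local Notation W k := (homog_poly R n.+1 m k).
Context (s r : nat) (e : 'I_r -> W q.+1).

(* The subspaces at which [e] is independent modulo the model kernel. *)
Definition transverse : set {vspace L} := [set b | \dim b = s /\
  forall z : 'rV[R]_r, killed b (\sum_j z 0 j *: e j) -> z = 0].

Lemma smooth_vect_graph_row (V : vectType R) t (e1 : s.-tuple V) (f1 : t.-tuple V) i M :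
  smooth_vect (fun M : 'M[R]_(s, t) => graph_row e1 f1 M i) M.
Proof. by move=> l; apply: smooth_graph_row => i' j'; exact: smooth_coord. Qed.

(** With zero right-hand side, [frame_solve] says that near the given point all solutions coincide;
    0 is one of them. *)
Lemma open_transverse : atlas_open (grass_atlas L s) transverse.
Proof.
move=> _ [e1 [f1 [bX ->]]]; rewrite openE => M /= [_ [dM ind]].
have ys (i : 'I_s) : smooth_vect (fun _ : 'M[R]_(s, \dim {:L} - s) => 0 : W q) M.
  by move=> l; exact: smooth_cst.
have [h [_ hE]] := frame_solve (smooth_vect_graph_row e1 f1 ^~ M) ys ind.
apply: filterS hE => M' hM'; split=> //; split=> [|z zk].
  exact: dim_graph_span.
have z0 : 0 = h M'.
  apply: hM' => i; rewrite big1 ?ddw0 // => j _.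
  by rewrite mxE scale0r.
by rewrite z0; apply: hM' => i; move: zk; rewrite graph_spanE => /killed_span.
Qed.

Lemma ddwB_eq0 k l (w w' : W k.+1) : ddw l (w - w') = 0 -> ddw l w' = ddw l w.
Proof.
rewrite (linearB (@ddw R n.+1 m k l)) => /eqP; rewrite subr_eq0 => /eqP.
by move=> ->.
Qed.

Lemma smooth_within_coor (coor : {vspace L} -> 'rV[R]_r) w b :
  (forall b, transverse b -> killed b (w - \sum_j coor b 0 j *: e j)) ->
  transverse b ->
  smooth_within (grass_atlas L s) (@vector_atlas R 'rV[R]_r) transverse coor b.
Proof.
move=> coorP Ob _ M [e1 [f1 [bX ->]]] /= _ ME; rewrite -ME in Ob.
have ys i : smooth_vect (fun M => ddwl w (graph_row e1 f1 M i)) M.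
  move=> l; exact: (smooth_vect_graph_row e1 f1 i M (l \o ddwl w)).
have [h [hs hE]] := frame_solve (smooth_vect_graph_row e1 f1 ^~ M) ys Ob.2.
exists (Param setT id), h; split=> //; apply: filterS hE => M' hM' OM'; split=> //=.
apply/esym/hM' => i; apply: ddwB_eq0.
by move: i; apply/killed_span; exact: coorP.
Qed.

Context (f : L -> N) (x0 : L).

Lemma shear_tau w l : shear w (tau f x0 l) = tau f x0 l + vert (ddw l w) :> J.
Proof.
have E : (tau f x0 l : J) = tau f x0 (tau f x0 l : J).1 + vert 0.
  by rewrite vert0 addr0 tau1.
by rewrite (shear_tau_vert w E) tau1 add0r.
Qed.

(** In the shear by [w] of the image of [tau], the vertical component of a vector is the derivative
    of [w] along its projection. Applied to the rows of a chart, this is a linear system for the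
    coordinates of [w] in the frame. *)
Lemma smooth_within_zeta (zeta : {vspace J} -> 'rV[R]_r) F :
  (forall F, elem f x0 s F -> transverse (underline q F) ->
     shearV (\sum_j zeta F 0 j *: e j) (linfun (@tau R n m q' f x0) @: underline q F)%VS = F) ->
  elem f x0 s F -> transverse (underline q F) ->
  smooth_within (grass_atlas J s) (@vector_atlas R 'rV[R]_r)
    ([set F | elem f x0 s F] `&` underline q @^-1` transverse) zeta F.
Proof.
move=> zetaP EF OF _ M [e1 [f1 [bX ->]]] /= _ ME.
pose g i (M' : 'M[R]_(s, \dim {:J} - s)) : L := (graph_row e1 f1 M' i).1.
have gE M' : underline q (graph_span e1 f1 M') = <<[seq g i M' | i <- enum 'I_s]>>%VS.
  rewrite /underline limg_span_seq; congr (<<_>>)%VS; apply: eq_map => i.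
  by rewrite lfunE.
have gs i : smooth_vect (g i) M.
  move=> l; pose lf : {linear J -> R^o} := (l \o @fst L arr).
  exact: (smooth_vect_graph_row e1 f1 i M lf).
have ys i : smooth_vect (fun M => vpart f x0 (graph_row e1 f1 M i)) M.
  move=> l; pose lf : {linear J -> R^o} := (l \o @vpart R n m q' f x0).
  exact: (smooth_vect_graph_row e1 f1 i M lf).
have ind : forall z : 'rV[R]_r,
   killed <<[seq g i M | i <- enum 'I_s]>>%VS (\sum_j z 0 j *: e j) -> z = 0.
  by rewrite -gE ME; exact: OF.2.
have [h [hs hE]] := frame_solve gs ys ind.
exists (Param setT id), h; split=> //; apply: filterS hE => M' hM' [EM' OM']; split=> //=.
apply/esym/hM' => i; have := zetaP _ EM' OM'.
set w := \sum_j _ => FE.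
have : graph_row e1 f1 M' i \in graph_span e1 f1 M'.
  by rewrite graph_spanE; apply: memv_span; apply/mapP; exists i; rewrite ?mem_enum.
rewrite -{1}FE => /shearVP[_ /memv_imgP[l _ ->] uE].
rewrite lfunE shear_tau in uE.
by rewrite /g uE vpartE /= tau1 addr0.
Qed.

(** The image is spanned by vectors affine in the chart matrix and, for a fixed matrix, affine in
    the fibre coordinate. They are free at the given point because neither [tau] nor a shear lowers
    the dimension. *)
Lemma smooth_within_psi (z : 'rV[R]_r) b : \dim b = s ->
  smooth_within (@prod_atlas R _ 'rV[R]_r _ (grass_atlas L s)) (grass_atlas J s)
    (fst @^-1` transverse)
    (fun y : {vspace L} * 'rV[R]_r =>
       shearV (\sum_j y.2 0 j *: e j) (linfun (@tau R n m q' f x0) @: y.1)%VS)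
    (b, z).
Proof.
move=> db _ [M zz] [_ [e1 [f1 [bX ->]]] <-] /= _ [ME _].
pose w (y : 'rV[R]_r) := \sum_j y 0 j *: e j.
pose u i (x : 'M[R]_(s, \dim {:L} - s) * 'rV[R]_r) : J :=
  shear (w x.2) (tau f x0 (graph_row e1 f1 x.1 i)).
have uE x : shearV (w x.2) (linfun (@tau R n m q' f x0) @: graph_span e1 f1 x.1)%VS =
    <<[seq u i x | i <- enum 'I_s]>>%VS.
  rewrite graph_spanE /shearV !limg_span_seq; congr (<<_>>)%VS; apply: eq_map => i.
  by rewrite !lfunE.
have fstS i j : smooth_at (fun x : 'M[R]_(s, \dim {:L} - s) * 'rV[R]_r => x.1 i j : R^o) (M, zz).
  exact: (smooth_mx _ _).2 (smooth_fst _) i j.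
have us i : smooth_vect (u i) (M, zz).
  move=> l; have E (x : 'M[R]_(s, \dim {:L} - s) * 'rV[R]_r) : l (tau f x0 (graph_row e1 f1 x.1 i)) +
      \sum_j x.2 0 j * l (vert (ddwl (e j) (graph_row e1 f1 x.1 i))) = l (u i x).
    rewrite /u shear_tau (linearD l); congr (_ + _); rewrite /w /ddwl.
    move: (graph_row e1 f1 x.1 i) => v.
    pose h : {linear W q.+1 -> J} := (@vert R n m q' \o @ddw R n.+1 m q v).
    by rewrite -(linear_functional_comb h l).
  under eq_fun do rewrite -E.
  apply: smoothD.
    pose lf : {linear L -> R^o} := (l \o @tau R n m q' f x0).
    exact: (smooth_graph_row e1 f1 i lf fstS).
  apply: smooth_sum => j _; apply: smoothM.
    exact: (smooth_mx _ _).2 (smooth_snd _) 0 j.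
  pose lf : {linear L -> R^o} := (l \o (@vert R n m q' \o ddwl (e j))).
  exact: (smooth_graph_row e1 f1 i lf fstS).
have fr : free [seq u i (M, zz) | i <- enum 'I_s].
  apply: free_of_dim; rewrite -uE dim_shearV /= ME.
  by have [dT _ _ _] := @elem_tau R n m q' f x0 s b db.
have [d [g [dA gs gE]]] := smooth_grass us fr.
exists d, g; split=> //; apply: filterS gE => x [dg gE] _; split=> //.
by rewrite gE -uE.
Qed.

End Trivialization.

Lemma killedB (R : realType) n m k (b : {vspace 'rV[R]_n.+1})
    (w w' : homog_poly R n.+1 m k) : killed b w -> killed b w' -> killed b (w - w').
Proof.
move=> wk wk' l lb j; rewrite [(w - w') j]ffunE [X in _ + X]ffunE.
by rewrite [LHS](linearB (dd l)) /= (wk l lb j) (wk' l lb j) subr0.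
Qed.

Lemma elem_affine_bundle (R : realType) (n m q' s : nat)
    (f : 'rV[R]_n.+1 -> 'rV[R]_m) (x0 : 'rV[R]_n.+1) :
  smooth_affine_bundle
    (grass_atlas (jet_coords R n.+1 m q'.+1) s)
    [set F | elem f x0 s F]
    (grass_atlas 'rV[R]_n.+1 s) (grass 'rV[R]_n.+1 s)
    (underline q'.+1)
    (homog_poly R n.+1 m q'.+2) (model_kernel n.+1 m q'.+2).
Proof.
have [r frame] := @killed_frame R n m s q'.+2.
exists r, (fun F w => shearV w F); split=> [F EF|F EF|b0 db0].
- by split; [exact: dim_underline EF|exact: smooth_within_underline].
- split=> [w|w w'|w|F' EF' FF'].
  + by split; [exact: elem_shearV|exact: underline_shearV].
  + exact: shearVD.
  + by split=> [/(shearV_fix w EF)/model_kernelP|/model_kernelP/(shearV_fix w EF)].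
  + exact: elem_transitive EF EF' (esym FF').
have [e [e0 eE]] := frame _ db0.
pose O := @transverse R n m q' s r e.
(* The origin of each fibre is the part of the fixed integral element [L] over [b]; this section is
   defined on the whole Grassmannian. *)
pose sigma (b : {vspace 'rV[R]_n.+1}) := (linfun (@tau R n m q' f x0) @: b)%VS.
have /choice[coorO coorOP] : forall wb : homog_poly R n.+1 m q'.+2 * {vspace 'rV[R]_n.+1},
    exists z : 'rV[R]_r, O wb.2 -> killed wb.2 (wb.1 - \sum_j z 0 j *: e j).
  move=> [w b]; have [[db ind]|nO] := pselect (O b); last by exists 0.
  by have [z zk] := eE _ db ind w; exists z.
pose coor w b := coorO (w, b).
have coorP (w : homog_poly R n.+1 m q'.+2) b : O b -> killed b (w - \sum_j coor w b 0 j *: e j).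
  exact: (coorOP (w, b)).
have /choice[zeta zetaP] : forall F : {vspace jet_coords R n.+1 m q'.+1},
    exists z : 'rV[R]_r, elem f x0 s F -> O (underline q'.+1 F) ->
      shearV (\sum_j z 0 j *: e j) (sigma (underline q'.+1 F)) = F.
  move=> F; have [[EF OF]|nF] := pselect (elem f x0 s F /\ O (underline q'.+1 F)); last first.
    by exists 0 => EF OF; case: nF.
  have Es : elem f x0 s (sigma (underline q'.+1 F)).
    by apply: elem_tau; exact: dim_underline EF.
  have [w wE] := elem_transitive Es EF (underline_tau f x0 _).
  (* Replacing [w] by its component in the frame changes it by a polynomial killed by the base,
     whose shear fixes [sigma] of that base. *)
  exists (coor w (underline q'.+1 F)) => _ _.
  rewrite {3}wE -[in RHS](subrK (\sum_j coor w (underline q'.+1 F) 0 j *: e j) w).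
  rewrite -shearVD; congr shearV; apply: esym; apply/(shearV_fix _ Es).
  by rewrite underline_tau; exact: coorP.
exists O, (fun i _ => e i), coor, sigma, zeta; split.
- by split; [split|move=> b []|exact: open_transverse].
- move=> b Ob; split=> [i|w|w z].
  + move=> c a _ _ _; exists 1%N, (fun=> const_mx 1), (fun=> e i); split.
      exact: smooth_cst.
    by apply: filterE => a'; rewrite big_ord1 mxE scale1r.
  + exact: smooth_within_coor (coorP w) Ob.
  split=> [/model_kernelP zk|->]; last by apply/model_kernelP; exact: coorP.
  (* In [smooth_affine_bundle], [z] ranges over functions of two indices rather
     than row vectors: [coor w b] is coerced. *)
  have [_ ind] := Ob; pose y : 'rV[R]_r := \row_i z 0 i.
  suff yE : y = coor w b.
    by apply/funext => i; apply/funext => j; rewrite -yE mxE ord1.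
  apply/eqP; rewrite -subr_eq0; apply/eqP; apply: ind.
  suff -> : \sum_j (y - coor w b) 0 j *: e j =
      (w - \sum_j coor w b 0 j *: e j) - (w - \sum_j z 0 j *: e j).
    exact: (killedB (coorP w b Ob) zk).
  have cancel (V : zmodType) (u v v' : V) : u - v - (u - v') = v' - v.
    by rewrite opprB addrC addrA subrK.
  rewrite cancel -sumrB.
  by apply: eq_bigr => j _; rewrite !mxE scalerBl.
- by move=> b Ob; split; [exact: elem_tau Ob.1|exact: underline_tau].
- by move=> b z Ob; exact: smooth_within_psi Ob.1.
move=> F EF OF; split; first exact: zetaP.
exact: (smooth_within_zeta zetaP EF OF).
Qed.

Theorem theorem1 (R : realType) (n m k s : nat)
    (hn : (1 <= n)%N) (hm : (1 <= m)%N) (hk : (2 <= k)%N)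
    (hs : (1 <= s <= n)%N)
    (E : Type) (A : set (param 'rV[R]_(n + m) E)) (hE : smooth_manifold A)
    (S0 : set E) (hS0 : submanifold A S0)
    (c : param 'rV[R]_(n + m) E) (hc : admissible A c)
    (a : 'rV[R]_(n + m)) (ha : pdom c a) (hy : S0 (c a))
    (f : 'rV[R]_n -> 'rV[R]_m) (hf : graph_near c a S0 f) :
  smooth_affine_bundle
    (grass_atlas (jet_coords R n m k.-1) s)
    (integral_elements k.-1 s A c a f)
    (grass_atlas 'rV[R]_n s) (grass 'rV[R]_n s)
    (underline k.-1)
    (homog_poly R n m k) (model_kernel n m k).
Proof.
case: n => [//|n] in hn hs A hE S0 hS0 c hc a ha hy f hf *.
(* With [k = q'.+2] the jets have order [q'.+1], which is positive, and the model polynomials have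
   degree one more. *)
case: k => [//|[//|q']] in hk *; rewrite [q'.+2.-1]/=.
have -> : integral_elements q'.+1 s A c a f = [set F | elem f (lsubmx a) s F].
  by apply/seteqP; split=> F /(integral_elementsP _ _ hc ha hy hf).
exact: elem_affine_bundle.
Qed.
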